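(* Let $t$ be a closed term of $\Lambda_B$ such that $;\vdash t:\mathbf{W}\Rightarrow \S^n\mathbf{Bool}$ or $;\vdash t:\mathbf{W}\multimap \S^n\mathbf{Bool}$ (for some $n\in\mathbb{N}$) has a $\mathbf{DLAL_B}$ derivation of depth $d$. Then the language $\mathcal{L}(t)$ represented by $t$ is decided by an alternating Turing machine whose running time on input $w$ is $O(m^{3^{d+4}})$, where $m$ is the size of the $\lambda$-term $t\,\underline{w}$. In particular $\mathcal{L}(t)\in \mathrm{APTIME}$.
   Context: System $\mathbf{DLAL_B}$. Types: $A,B::=\alpha\mid A\multimap B\mid A\Rightarrow B\mid \S A\mid \forall\alpha.A\mid \mathbf{Bool}$. Terms of $\Lambda_B$: $t,u,v::=x\mid F\mid T\mid \lambda x.t\mid t\,u\mid \mathrm{if}\ t\ \mathrm{then}\ u\ \mathrm{else}\ v$. Besides $\beta$-reduction there is $\delta$-reduction, the contextual closure of $(\mathrm{if}\ T\ \mathrm{then}\ u\ \mathrm{else}\ v)\to u$ and $(\mathrm{if}\ F\ \mathrm{then}\ u\ \mathrm{else}\ v)\to v$. Judgements are $\Gamma;\Delta\vdash t:A$ where $\Gamma$ (non-linear) and $\Delta$ (linear) assign types to distinct variables, with disjoint domains. Rules: (Id) $;x:A\vdash x:A$. ($\multimap$i) from $\Gamma;\Delta,x:A\vdash t:B$ infer $\Gamma;\Delta\vdash\lambda x.t:A\multimap B$. ($\multimap$e) from $\Gamma_1;\Delta_1\vdash t:A\multimap B$ and $\Gamma_2;\Delta_2\vdash u:A$ infer $\Gamma_1,\Gamma_2;\Delta_1,\Delta_2\vdash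 t\,u:B$. ($\Rightarrow$i) from $\Gamma,x:A;\Delta\vdash t:B$ infer $\Gamma;\Delta\vdash \lambda x.t:A\Rightarrow B$. ($\Rightarrow$e) from $\Gamma;\Delta\vdash t:A\Rightarrow B$ and $;z:C\vdash u:A$ infer $\Gamma,z:C;\Delta\vdash t\,u:B$ (the right premise may also be $;\vdash u:A$, with conclusion $\Gamma;\Delta\vdash t\,u:B$). (Weak) from $\Gamma_1;\Delta_1\vdash t:A$ infer $\Gamma_1,\Gamma_2;\Delta_1,\Delta_2\vdash t:A$. (Cntr) from $x_1:A,x_2:A,\Gamma;\Delta\vdash t:B$ infer $x:A,\Gamma;\Delta\vdash t[x/x_1,x/x_2]:B$. ($\S$i) from $;\Gamma,\Delta\vdash t:A$ infer $\Gamma;\S\Delta\vdash t:\S A$ ($\S\Delta$ prefixes $\S$ to every type of $\Delta$). ($\S$e) from $\Gamma_1;\Delta_1\vdash u:\S A$ and $\Gamma_2;x:\S A,\Delta_2\vdash t:B$ infer $\Gamma_1,\Gamma_2;\Delta_1,\Delta_2\vdash t[u/x]:B$. ($\forall$i) from $\Gamma;\Delta\vdash t:A$ infer $\Gamma;\Delta\vdash t:\forall\alpha.A$ if $\alpha$ is not free in $\Gamma,\Delta$. ($\forall$e) from $\Gamma;\Delta\vdash t:\forall\alpha.A$ infer $\Gamma;\Delta\vdash t:A[B/\alpha]$. ($B_0$i) $;\vdash F:\mathbf{Bool}$; ($B_1$i) $;\vdash T:\mathbf{Bool}$. ($B$e) from $\Gamma;\Delta\vdash M_0:\S^k\mathbf{Bool}$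 ($k\in\mathbb{N}$), $\Gamma;\Delta\vdash M_1:A$, $\Gamma;\Delta\vdash M_2:A$ infer $\Gamma;\Delta\vdash \mathrm{if}\ M_0\ \mathrm{then}\ M_1\ \mathrm{else}\ M_2:A$. The depth of a derivation is the maximal number, along a branch, of premises of ($\S$i) rules and right-hand premises of ($\Rightarrow$e) rules. Binary words: $\mathbf{W}=\forall\alpha.(\alpha\multimap\alpha)\Rightarrow(\alpha\multimap\alpha)\Rightarrow\S(\alpha\multimap\alpha)$ and for $w=i_1\cdots i_n\in\{0,1\}^*$, $\underline{w}=\lambda f_0.\lambda f_1.\lambda x.f_{i_1}(f_{i_2}(\cdots(f_{i_n}x)\cdots))$. Typed terms are strongly normalizing and confluent for $\beta\delta$; $\mathcal{L}(t)$ is the set of words $w$ such that the $\beta\delta$-normal form of $t\,\underline{w}$ is $T$ (for such $t$ the normal form is always $T$ or $F$). *)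

(* Defs.v *)
From HB Require Import structures.
From mathcomp Require Import all_boot.
From Stdlib Require Import Relation_Operators.

Set Implicit Arguments.
Unset Strict Implicit.
Unset Printing Implicit Defensive.

(** * Syntax up to alpha-equivalence

    Terms and types are in de Bruijn form. A free variable is a natural number,
    used as its name; [lam x t] and [tall a A] bind a *named* variable, so that
    the typing rules below can be written as with named variables. *)

Definition upr (r : nat -> nat) (x : nat) : nat :=
  if x is y.+1 then (r y).+1 else 0.

(* The renaming under which the name [x] becomes the innermost bound index. *)
Definition bind (x y : nat) : nat := if y == x then 0 else y.+1.

Inductive ty : Type :=
| TVar (a : nat)
| Lin (A B : ty)            (* linear arrow *)
| Arr (A B : ty)            (* intuitionistic arrow *)
| Par (A : ty)              (* paragraph modality *)
| All (A : ty)
| Bool.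

Lemma ty_eq_dec (A B : ty) : decidable (A = B).
Proof. by rewrite /decidable; decide equality; apply: eq_comparable. Defined.

HB.instance Definition _ := hasDecEq.Build ty (compareP ty_eq_dec).

Fixpoint tren (r : nat -> nat) (A : ty) : ty :=
  match A with
  | TVar a => TVar (r a)
  | Lin A B => Lin (tren r A) (tren r B)
  | Arr A B => Arr (tren r A) (tren r B)
  | Par A => Par (tren r A)
  | All A => All (tren (upr r) A)
  | Bool => Bool
  end.

Definition tups (s : nat -> ty) (a : nat) : ty :=
  if a is b.+1 then tren succn (s b) else TVar 0.

Fixpoint tsubst (s : nat -> ty) (A : ty) : ty :=
  match A with
  | TVar a => s a
  | Lin A B => Lin (tsubst s A) (tsubst s B)
  | Arr A B => Arr (tsubst s A) (tsubst s B)
  | Par A => Par (tsubst s A)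
  | All A => All (tsubst (tups s) A)
  | Bool => Bool
  end.

(* [A[B/a]] *)
Definition tsub (a : nat) (B A : ty) : ty :=
  tsubst (fun b => if b == a then B else TVar b) A.

Definition tall (a : nat) (A : ty) : ty := All (tren (bind a) A).

Fixpoint tfree (a : nat) (A : ty) : bool :=
  match A with
  | TVar b => b == a
  | Lin A B | Arr A B => tfree a A || tfree a B
  | Par A => tfree a A
  | All A => tfree a.+1 A
  | Bool => false
  end.

Inductive tm : Type :=
| Var (x : nat)
| tmF
| tmT
| Lam (t : tm)
| App (t u : tm)
| If (t u v : tm).

Fixpoint ren (r : nat -> nat) (t : tm) : tm :=
  match t with
  | Var x => Var (r x)
  | tmF => tmF
  | tmT => tmT
  | Lam t => Lam (ren (upr r) t)
  | App t u => App (ren r t) (ren r u)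
  | If t u v => If (ren r t) (ren r u) (ren r v)
  end.

Definition ups (s : nat -> tm) (x : nat) : tm :=
  if x is y.+1 then ren succn (s y) else Var 0.

Fixpoint subst (s : nat -> tm) (t : tm) : tm :=
  match t with
  | Var x => s x
  | tmF => tmF
  | tmT => tmT
  | Lam t => Lam (subst (ups s) t)
  | App t u => App (subst s t) (subst s u)
  | If t u v => If (subst s t) (subst s u) (subst s v)
  end.

(* [t[u/x]] for a name [x] *)
Definition sub (x : nat) (u t : tm) : tm :=
  subst (fun y => if y == x then u else Var y) t.

(* The body [t] of [Lam t], with its bound variable replaced by [u]. *)
Definition inst (t u : tm) : tm :=
  subst (fun x => if x is y.+1 then Var y else u) t.

Definition lam (x : nat) (t : tm) : tm := Lam (ren (bind x) t).

Fixpoint free (x : nat) (t : tm) : bool :=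
  match t with
  | Var y => y == x
  | tmF | tmT => false
  | Lam t => free x.+1 t
  | App t u => free x t || free x u
  | If t u v => [|| free x t, free x u | free x v]
  end.

Definition closed_tm (t : tm) : Prop := forall x, ~~ free x t.

Fixpoint tmsize (t : tm) : nat :=
  match t with
  | Var _ | tmF | tmT => 1
  | Lam t => (tmsize t).+1
  | App t u => (tmsize t + tmsize u).+1
  | If t u v => (tmsize t + tmsize u + tmsize v).+1
  end.

(** * Reduction *)

Inductive red : tm -> tm -> Prop :=
| red_beta t u : red (App (Lam t) u) (inst t u)
| red_ifT u v : red (If tmT u v) u
| red_ifF u v : red (If tmF u v) v
| red_lam t t' : red t t' -> red (Lam t) (Lam t')
| red_appl t t' u : red t t' -> red (App t u) (App t' u)
| red_appr t u u' : red u u' -> red (App t u) (App t u')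
| red_if0 t t' u v : red t t' -> red (If t u v) (If t' u v)
| red_if1 t u u' v : red u u' -> red (If t u v) (If t u' v)
| red_if2 t u v v' : red v v' -> red (If t u v) (If t u v').

Definition normal (t : tm) : Prop := forall u, ~ red t u.

Definition normal_form_of (t u : tm) : Prop :=
  clos_refl_trans tm red t u /\ normal u.

(** * Typing derivations *)

Definition ctx := seq (nat * ty).

(* The declared variables are distinct and the two domains are disjoint. *)
Definition wf (G D : ctx) : bool := uniq (unzip1 (G ++ D)).

Definition parctx (D : ctx) : ctx := [seq (p.1, Par p.2) | p <- D].

Definition tfresh (a : nat) (G : ctx) : bool :=
  all (fun p => ~~ tfree a p.2) G.

(* [deriv G D t A] is the type of derivations of [G; D |- t : A]. Contexts are
   lists, made unordered by the structural constructor [d_exch]; [wf] is required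
   where contexts are merged or extended, and is inherited in the other rules.
   [d_arre0] is the case of the elimination of [Arr] in which the argument has an
   empty context. *)
Inductive deriv : ctx -> ctx -> tm -> ty -> Type :=
| d_exch G G' D D' t A :
    perm_eq G G' -> perm_eq D D' -> deriv G D t A -> deriv G' D' t A
| d_id x A :
    deriv [::] [:: (x, A)] (Var x) A
| d_lini G D x t A B :
    deriv G ((x, A) :: D) t B -> deriv G D (lam x t) (Lin A B)
| d_line G1 G2 D1 D2 t u A B :
    wf (G1 ++ G2) (D1 ++ D2) ->
    deriv G1 D1 t (Lin A B) -> deriv G2 D2 u A ->
    deriv (G1 ++ G2) (D1 ++ D2) (App t u) B
| d_arri G D x t A B :
    deriv ((x, A) :: G) D t B -> deriv G D (lam x t) (Arr A B)
| d_arre G D z C t u A B :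
    wf ((z, C) :: G) D ->
    deriv G D t (Arr A B) -> deriv [::] [:: (z, C)] u A ->
    deriv ((z, C) :: G) D (App t u) B
| d_arre0 G D t u A B :
    deriv G D t (Arr A B) -> deriv [::] [::] u A ->
    deriv G D (App t u) B
| d_weak G1 G2 D1 D2 t A :
    wf (G1 ++ G2) (D1 ++ D2) ->
    deriv G1 D1 t A -> deriv (G1 ++ G2) (D1 ++ D2) t A
| d_cntr G D x x1 x2 t A B :
    wf ((x, A) :: G) D ->
    deriv ((x1, A) :: (x2, A) :: G) D t B ->
    deriv ((x, A) :: G) D
      (ren (fun y => if (y == x1) || (y == x2) then x else y) t) B
| d_pari G D t A :
    deriv [::] (G ++ D) t A -> deriv G (parctx D) t (Par A)
| d_pare G1 G2 D1 D2 x t u A B :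
    wf (G1 ++ G2) (D1 ++ D2) ->
    deriv G1 D1 u (Par A) -> deriv G2 ((x, Par A) :: D2) t B ->
    deriv (G1 ++ G2) (D1 ++ D2) (sub x u t) B
| d_alli G D a t A :
    tfresh a (G ++ D) -> deriv G D t A -> deriv G D t (tall a A)
| d_alle G D a t A B :
    deriv G D t (tall a A) -> deriv G D t (tsub a B A)
| d_booli0 : deriv [::] [::] tmF Bool
| d_booli1 : deriv [::] [::] tmT Bool
| d_boole G D k t u v A :
    deriv G D t (iter k Par Bool) -> deriv G D u A -> deriv G D v A ->
    deriv G D (If t u v) A.

Fixpoint depth G D t A (p : deriv G D t A) : nat :=
  match p with
  | d_exch _ _ _ _ _ _ _ _ p1 => depth p1
  | d_id _ _ => 0
  | d_lini _ _ _ _ _ _ p1 => depth p1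
  | d_line _ _ _ _ _ _ _ _ _ p1 p2 => maxn (depth p1) (depth p2)
  | d_arri _ _ _ _ _ _ p1 => depth p1
  | d_arre _ _ _ _ _ _ _ _ _ p1 p2 => maxn (depth p1) (depth p2).+1
  | d_arre0 _ _ _ _ _ _ p1 p2 => maxn (depth p1) (depth p2).+1
  | d_weak _ _ _ _ _ _ _ p1 => depth p1
  | d_cntr _ _ _ _ _ _ _ _ _ p1 => depth p1
  | d_pari _ _ _ _ p1 => (depth p1).+1
  | d_pare _ _ _ _ _ _ _ _ _ _ p1 p2 => maxn (depth p1) (depth p2)
  | d_alli _ _ _ _ _ _ p1 => depth p1
  | d_alle _ _ _ _ _ _ p1 => depth p1
  | d_booli0 => 0
  | d_booli1 => 0
  | d_boole _ _ _ _ _ _ _ p1 p2 p3 =>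
      maxn (depth p1) (maxn (depth p2) (depth p3))
  end.

Definition has_deriv_of_depth (d : nat) (G D : ctx) (t : tm) (A : ty) : Prop :=
  exists p : deriv G D t A, depth p = d.

(** * Binary words and represented languages *)

Definition word := seq bool.

Definition language := word -> Prop.

Definition tyW : ty :=
  let e := Lin (TVar 0) (TVar 0) in tall 0 (Arr e (Arr e (Par e))).

(* The names of f_0, f_1 and x are 0, 1 and 2; a letter [i : bool] is coerced
   to the name of f_i. *)
Definition church (w : word) : tm :=
  lam 0 (lam 1 (lam 2 (foldr (fun (i : bool) u => App (Var i) u) (Var 2) w))).

Definition lang (t : tm) : language :=
  fun w => normal_form_of (App t (church w)) tmT.

(** * Alternating Turing machines

    Machines have finitely many two-way infinite tapes. The input is written on
    tape [ord0], with the head on its first letter; the other tapes are blank. *)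

Inductive mode := Existential | Universal | Accepting | Rejecting.

Inductive move := MoveLeft | MoveRight | Stay.

Record atm := ATM {
  extra_tapes : nat;
  state : finType;
  symbol : finType;
  blank : symbol;
  letter : bool -> symbol;
  letter_inj : injective letter;
  letter_blank : forall i, letter i != blank;
  start : state;
  kind : state -> mode;
  delta : state -> {ffun 'I_extra_tapes.+1 -> symbol} ->
          seq (state * {ffun 'I_extra_tapes.+1 -> symbol * move}) }.

Section Machine.
Variable M : atm.

(* (l, h, r): the scanned symbol is h, the symbols to its left are l, nearest
   first, those to its right are r, and all the other cells are blank. *)
Definition tape : Type := seq (symbol M) * symbol M * seq (symbol M).

Definition config : Type := state M * {ffun 'I_(extra_tapes M).+1 -> tape}.

Definition action : Type :=
  state M * {ffun 'I_(extra_tapes M).+1 -> symbol M * move}.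

Definition act (p : tape) (a : symbol M * move) : tape :=
  let: (l, _, r) := p in
  let: (s, m) := a in
  match m with
  | Stay => (l, s, r)
  | MoveLeft => if l is x :: l' then (l', x, s :: r)
                else ([::], blank M, s :: r)
  | MoveRight => if r is x :: r' then (s :: l, x, r')
                 else (s :: l, blank M, [::])
  end.

Definition halting (q : state M) : bool :=
  match kind q with Accepting | Rejecting => true | _ => false end.

Definition successors (c : config) : seq config :=
  let: (q, tp) := c in
  if halting q then [::] else
  [seq (b.1, [ffun i => act (tp i) (b.2 i)])
     | b : action <- delta q [ffun i => (tp i).1.2]].

Definition mstep : rel config := [rel c c' | c' \in successors c].

Definition input_tape (w : word) : tape :=
  if w is i :: w' then ([::], letter M i, map (@letter M) w')
  else ([::], blank M, [::]).

Definition initial (w : word) : config :=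
  (start M, [ffun i => if i == ord0 then input_tape w
                       else ([::], blank M, [::])]).

Inductive accepts : config -> Prop :=
| acc_accepting c : kind c.1 = Accepting -> accepts c
| acc_existential c c' :
    kind c.1 = Existential -> mstep c c' -> accepts c' -> accepts c
| acc_universal c :
    kind c.1 = Universal -> (forall c', mstep c c' -> accepts c') ->
    accepts c.

(* Every computation from the initial configuration halts within [T] steps. *)
Definition runs_within (w : word) (T : nat) : Prop :=
  forall s, path mstep (initial w) s -> size s <= T.

Definition decides_within (L : language) (T : word -> nat) : Prop :=
  forall w, runs_within w (T w) /\ (accepts (initial w) <-> L w).

End Machine.

Definition APTIME (L : language) : Prop :=
  exists (M : atm) (c k : nat),
    decides_within M L (fun w => c * size w ^ k + c).

(* Main.v *)
From HB Require Import structures.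
Require Import Defs.
From mathcomp Require Import all_boot zify.
From Stdlib Require Import FunctionalExtensionality Relation_Operators.

(* Closed terms are run by a call-by-name head machine with an argument stack.
   On [if t then u else v] an alternating machine guesses the value of [t], then
   either verifies the guess, dropping the stack, or goes on with the branch. It
   thus follows a single one of [t], [u], [v] along each path, so the sharing of
   contexts in (Be) costs nothing and a path is no longer than a head reduction
   in DLAL.

   The length of the paths is bounded by realizability, by induction on typing
   derivations and without subject reduction. A realizer of a type carries a
   resource with, at each level, an additive component [x], an additive increment
   [i] of the contents of all boxes, and the maximum [y] of the contents of the
   boxes. [down] executes a level: each of its [x 1] units opens one box, of
   contents at most [i + y]. The paragraph modality is interpreted by [down]
   itself. Running [down] squares the resources, and a derivation of depth [d] has
   resources on [d + 1] levels, which gives a bound polynomial in [|w|] of degree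
   [4 * 2 ^ d] for the term [t w].

   Along a path the terms may grow exponentially, since both branches of a
   conditional contain copies of the arguments; the Turing machine therefore
   implements the head machine with closures and environments shared in a heap,
   with unary pointers, at a cost that is a fifth power of the number of steps.
   To have a finite set of codes, the word [w] is stored as a chain of closures
   which decodes to a term that reduces to the Church word [church w]; that the two
   define the same language follows from confluence. *)

Set Implicit Arguments.
Unset Strict Implicit.
Unset Printing Implicit Defensive.

(** * Substitution *)

Lemma upr_comp r r' : upr r' \o upr r =1 upr (r' \o r).
Proof. by case. Qed.

Lemma eq_ren r r' t : r =1 r' -> ren r t = ren r' t.
Proof. by move=> /functional_extensionality->. Qed.

Lemma eq_subst s s' t : s =1 s' -> subst s t = subst s' t.
Proof. by move=> /functional_extensionality->. Qed.

Lemma ren_ren r r' t : ren r' (ren r t) = ren (r' \o r) t.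
Proof.
elim: t r r' => //= [t IH|t IHt u IHu|t IHt u IHu v IHv] r r'.
- by rewrite IH (eq_ren _ (upr_comp _ _)).
- by rewrite IHt IHu.
- by rewrite IHt IHu IHv.
Qed.

Lemma subst_ren s r t : subst s (ren r t) = subst (s \o r) t.
Proof.
elim: t s r => //= [t IH|t IHt u IHu|t IHt u IHu v IHv] s r.
- by rewrite IH; congr Lam; apply: eq_subst; case.
- by rewrite IHt IHu.
- by rewrite IHt IHu IHv.
Qed.

Lemma ren_subst s r t : ren r (subst s t) = subst (ren r \o s) t.
Proof.
elim: t s r => //= [t IH|t IHt u IHu|t IHt u IHu v IHv] s r.
- rewrite IH; congr Lam; apply: eq_subst; case=> //= x.
  by rewrite !ren_ren.
- by rewrite IHt IHu.
- by rewrite IHt IHu IHv.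
Qed.

Lemma subst_subst s s' t : subst s' (subst s t) = subst (subst s' \o s) t.
Proof.
elim: t s s' => //= [t IH|t IHt u IHu|t IHt u IHu v IHv] s s'.
- rewrite IH; congr Lam; apply: eq_subst; case=> //= x.
  by rewrite subst_ren ren_subst.
- by rewrite IHt IHu.
- by rewrite IHt IHu IHv.
Qed.

Lemma subst_var t : subst Var t = t.
Proof.
elim: t => //= [t IH|t -> u ->|t -> u -> v ->] //.
by rewrite (eq_subst (s' := Var)) ?IH //; case.
Qed.

Lemma ren_as_subst r t : ren r t = subst (Var \o r) t.
Proof. by rewrite -{1}[t]subst_var ren_subst. Qed.

Definition scons (u : tm) (s : nat -> tm) (x : nat) : tm :=
  if x is y.+1 then s y else u.

Lemma inst_ups s t u : inst (subst (ups s) t) u = subst (scons u s) t.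
Proof.
rewrite /inst subst_subst; apply: eq_subst; case=> //= x.
by rewrite subst_ren -[RHS]subst_var; apply: eq_subst.
Qed.

Lemma subst_inst s t u : subst s (inst t u) = inst (subst (ups s) t) (subst s u).
Proof.
by rewrite inst_ups /inst subst_subst; apply: eq_subst; case.
Qed.

Lemma ren_inst r t u : ren r (inst t u) = inst (ren (upr r) t) (ren r u).
Proof.
by rewrite /inst ren_subst subst_ren; apply: eq_subst; case.
Qed.

Definition upd T (f : nat -> T) (x : nat) (v : T) (y : nat) : T :=
  if y == x then v else f y.

Lemma subst_sub s x u t : subst s (sub x u t) = subst (upd s x (subst s u)) t.
Proof.
by rewrite /sub subst_subst; apply: eq_subst => y /=; rewrite /upd; case: eqP.
Qed.

Lemma subst_lam s x t : subst s (lam x t) = Lam (subst (ups s \o bind x) t).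
Proof. by rewrite /= subst_ren. Qed.

(** Links the named binder of the typing rules with de Bruijn instantiation: entering an abstraction
    just updates the substitution at [x], without shifting. *)
Lemma inst_subst_lam s x t u :
  inst (subst (ups s \o bind x) t) u = subst (upd s x u) t.
Proof.
rewrite -subst_ren inst_ups subst_ren; apply: eq_subst => y /=.
by rewrite /bind /upd; case: eqP.
Qed.

Lemma eq_free_subst s s' t :
  (forall x, free x t -> s x = s' x) -> subst s t = subst s' t.
Proof.
elim: t s s' => //= [x|t IH|t IHt u IHu|t IHt u IHu v IHv] s s' E.
- exact: E.
- by congr Lam; apply: IH; case=> //= x fx; rewrite E.
- by rewrite (IHt s s') 1?(IHu s s') // => x fx; apply: E; rewrite fx ?orbT.
- by rewrite (IHt s s') 1?(IHu s s') 1?(IHv s s') // => x fx; apply: E;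
    rewrite fx ?orbT.
Qed.

Lemma closed_subst s t : closed_tm t -> subst s t = t.
Proof.
move=> ct; rewrite -[RHS]subst_var; apply: eq_free_subst => x fx.
by move: (ct x); rewrite fx.
Qed.

Lemma closed_ren r t : closed_tm t -> ren r t = t.
Proof. by move=> ct; rewrite ren_as_subst closed_subst. Qed.

(** * Confluence *)

Notation reds := (clos_refl_trans tm red).

Lemma reds_lift (f : tm -> tm) t u :
  (forall t u, red t u -> red (f t) (f u)) -> reds t u -> reds (f t) (f u).
Proof.
move=> fr; elim=> [x y /fr|x|x y z _ xy _ yz]; first exact: rt_step.
  exact: rt_refl.
exact: rt_trans xy yz.
Qed.

Lemma reds_lam t t' : reds t t' -> reds (Lam t) (Lam t').
Proof. by apply: reds_lift => *; constructor. Qed.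

Lemma reds_app t t' u u' : reds t t' -> reds u u' -> reds (App t u) (App t' u').
Proof.
move=> tt' uu'; apply: (rt_trans _ _ _ (App t' u)).
  by apply: (reds_lift (f := App^~ u)) tt' => *; constructor.
by apply: reds_lift uu' => *; constructor.
Qed.

Lemma reds_if t t' u u' v v' :
  reds t t' -> reds u u' -> reds v v' -> reds (If t u v) (If t' u' v').
Proof.
move=> tt' uu' vv'; apply: (rt_trans _ _ _ (If t' u v)).
  by apply: (reds_lift (f := fun t => If t u v)) tt' => *; constructor.
apply: (rt_trans _ _ _ (If t' u' v)).
  by apply: (reds_lift (f := fun u => If t' u v)) uu' => *; constructor.
by apply: reds_lift vv' => *; constructor.
Qed.

(** Parallel reduction in the style of Tait and Martin-Löf, for beta and delta together. *)
Inductive par : tm -> tm -> Prop :=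
| par_var x : par (Var x) (Var x)
| par_F : par tmF tmF
| par_T : par tmT tmT
| par_lam t t' : par t t' -> par (Lam t) (Lam t')
| par_app t t' u u' : par t t' -> par u u' -> par (App t u) (App t' u')
| par_if t t' u u' v v' :
    par t t' -> par u u' -> par v v' -> par (If t u v) (If t' u' v')
| par_beta t t' u u' : par t t' -> par u u' -> par (App (Lam t) u) (inst t' u')
| par_ifT u u' v : par u u' -> par (If tmT u v) u'
| par_ifF u v v' : par v v' -> par (If tmF u v) v'.

#[local] Hint Constructors par : core.

Lemma par_refl t : par t t.
Proof. by elim: t => *; auto. Qed.

#[local] Hint Resolve par_refl : core.

Lemma red_par t u : red t u -> par t u.
Proof. by elim=> *; auto. Qed.

Lemma par_reds t u : par t u -> reds t u.
Proof.
elim=> *; try exact: rt_refl.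
- exact: reds_lam.
- exact: reds_app.
- exact: reds_if.
- apply: rt_trans (rt_step _ _ _ _ (red_beta _ _)).
  by apply: reds_app => //; apply: reds_lam.
- by apply: rt_trans; first exact: rt_step (red_ifT _ _).
- by apply: rt_trans; first exact: rt_step (red_ifF _ _).
Qed.

Lemma par_ren r t t' : par t t' -> par (ren r t) (ren r t').
Proof.
move=> tt'; elim: tt' r => /=; auto=> t0 t0' u u' _ IHt _ IHu r.
by rewrite ren_inst; auto.
Qed.

Lemma par_subst s s' t t' :
  (forall x, par (s x) (s' x)) -> par t t' -> par (subst s t) (subst s' t').
Proof.
move=> ss' tt'; elim: tt' s s' ss' => //=; auto.
  move=> t0 t0' _ IH s s' ss'; constructor; apply: IH; case=> //= x.
  exact: par_ren.
move=> t0 t0' u u' _ IHt _ IHu s s' ss'; rewrite subst_inst.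
by constructor; auto; apply: IHt; case=> //= x; apply: par_ren.
Qed.

Lemma par_inst t t' u u' : par t t' -> par u u' -> par (inst t u) (inst t' u').
Proof. by move=> tt' uu'; apply: par_subst => //; case. Qed.

(** Takahashi's complete development: all redexes present in the term are contracted at once. *)
Fixpoint dev (t : tm) : tm :=
  match t with
  | Lam t => Lam (dev t)
  | App (Lam t) u => inst (dev t) (dev u)
  | App t u => App (dev t) (dev u)
  | If tmT u _ => dev u
  | If tmF _ v => dev v
  | If t u v => If (dev t) (dev u) (dev v)
  | _ => t
  end.

Lemma par_dev t u : par t u -> par u (dev t).
Proof.
elim=> //=; auto.
- move=> t0 t0' u0 u0' tt' IHt uu' IHu.
  case: t0 tt' IHt => //= [x|||t0|t0 t1|t0 t1 t2]; auto.
  move=> tt' IHt; inversion tt'; subst.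
  by inversion IHt; subst; auto.
- move=> t0 t0' u0 u0' v v' tt' IHt _ IHu _ IHv.
  case: t0 tt' IHt => //= [x|||t0|t0 t1|t0 t1 t2]; auto.
    by move=> tt'; inversion tt'; auto.
  by move=> tt'; inversion tt'; auto.
- by move=> *; apply: par_inst.
Qed.

Lemma dev_par t u : par t u -> par (dev t) (dev u).
Proof. by move=> tu; apply: par_dev; apply: par_dev. Qed.

Notation pars := (clos_refl_trans_1n tm par).

Lemma reds_pars t u : reds t u -> pars t u.
Proof.
move=> /Operators_Properties.clos_rt_rt1n_iff.
elim=> [x|x y z xy _ yz]; first by constructor.
exact: Relation_Operators.rt1n_trans (red_par xy) yz.
Qed.

Lemma pars_reds t u : pars t u -> reds t u.
Proof.
elim=> [x|x y z xy _ yz]; first exact: rt_refl.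
exact: rt_trans (par_reds xy) yz.
Qed.

(** By the triangle property [par_dev], iterated developments are cofinal among the reducts of a
    term; two reducts therefore meet at a common iterate. *)
Lemma pars_iter_dev t u : pars t u -> exists n, forall m, n <= m -> pars u (iter m dev t).
Proof.
elim=> [x|x y z xy _ [n IH]].
  exists 0 => m _; apply: reds_pars; elim: m => [|m IHm]; first exact: rt_refl.
  by apply: rt_trans IHm _ => /=; apply/par_reds/par_dev.
exists n.+1 => -[//|m] lt_nm; apply: reds_pars.
apply: rt_trans (pars_reds (IH _ lt_nm)) _; rewrite iterSr.
apply: par_reds; elim: m {lt_nm} => [|m IHm] /=; first exact: par_dev.
exact: dev_par.
Qed.

Definition bool_tm (b : bool) : tm := if b then tmT else tmF.

Lemma normal_bool b : normal (bool_tm b).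
Proof. by case: b => u r; inversion r. Qed.

Lemma pars_bool b u : pars (bool_tm b) u -> u = bool_tm b.
Proof.
move E: (bool_tm b) => t tu; elim: tu E => // x y z xy _ IH E.
suff yx : y = x by rewrite yx in IH; apply: IH.
by case: b E {IH} xy => <- xy; inversion xy.
Qed.

Lemma reds_confluent_bool t u b :
  reds t (bool_tm b) -> reds t u -> reds u (bool_tm b).
Proof.
move=> /reds_pars/pars_iter_dev[n Hn] /reds_pars/pars_iter_dev[m Hm].
have := Hn _ (leq_maxl n m); have := Hm _ (leq_maxr n m).
by move=> um /pars_bool nm; apply: pars_reds; rewrite -nm.
Qed.

Lemma reds_bool_inj t b c : reds t (bool_tm b) -> reds t (bool_tm c) -> b = c.
Proof.
move=> tb /(reds_confluent_bool tb)/reds_pars/pars_bool.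
by case: b {tb}; case: c.
Qed.

(** * Head evaluation *)

(** Big-step form of the head machine. A truth value is a result only on an empty stack, and the
    test of a conditional runs on a fresh one. *)
Inductive ev : tm -> seq tm -> bool -> Prop :=
| ev_T : ev tmT [::] true
| ev_F : ev tmF [::] false
| ev_app t u s b : ev t (u :: s) b -> ev (App t u) s b
| ev_lam t u s b : ev (inst t u) s b -> ev (Lam t) (u :: s) b
| ev_if t u v s c b :
    ev t [::] c -> ev (if c then u else v) s b -> ev (If t u v) s b.

Definition apps (t : tm) (s : seq tm) : tm := foldl App t s.

Lemma apps_rcons t s u : apps t (rcons s u) = App (apps t s) u.
Proof. by rewrite /apps foldl_rcons. Qed.

Lemma reds_apps t t' s : reds t t' -> reds (apps t s) (apps t' s).
Proof.
elim: s t t' => //= u s IH t t' tt'; apply: IH.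
by apply: reds_app tt' (rt_refl _ _ _).
Qed.

Lemma ev_reds t s b : ev t s b -> reds (apps t s) (bool_tm b).
Proof.
elim=> //= {t s b}.
- exact: rt_refl.
- exact: rt_refl.
- move=> t u s b _ IH; apply: rt_trans IH.
  by apply: (@reds_apps (App (Lam t) u)); apply: rt_step; constructor.
- move=> t u v s c b _ IHt _ IHu; apply: rt_trans IHu; apply: reds_apps.
  apply: (rt_trans _ _ _ (If (bool_tm c) u v)).
    by apply: reds_if IHt _ _; apply: rt_refl.
  by apply: rt_step; case: c {IHt}; constructor.
Qed.

(** * Resources *)

Record res := Res { rx : nat -> nat; ri : nat -> nat; ry : nat -> nat }.

Definition r0 : res := Res (fun=> 0) (fun=> 0) (fun=> 0).

(** Contents are combined by a maximum, because one opening runs a single box, so only the largest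
    one matters. This is what makes contraction cheap. *)
Definition radd (p q : res) : res :=
  Res (fun k => rx p k + rx q k) (fun k => ri p k + ri q k)
      (fun k => maxn (ry p k) (ry q k)).

Infix "+r" := radd (at level 50, left associativity).

Lemma res_eq p q : rx p =1 rx q -> ri p =1 ri q -> ry p =1 ry q -> p = q.
Proof.
by case: p q => [? ? ?] [? ? ?] /= /functional_extensionality->
  /functional_extensionality-> /functional_extensionality->.
Qed.

Lemma raddA : associative radd.
Proof. by move=> p q r; apply: res_eq => k /=; rewrite ?addnA ?maxnA. Qed.

Lemma raddC : commutative radd.
Proof. by move=> p q; apply: res_eq => k /=; rewrite 1?addnC 1?maxnC. Qed.

Lemma radd0 : left_id r0 radd.
Proof. by move=> p; apply: res_eq => k /=; rewrite ?add0n ?max0n. Qed.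

HB.instance Definition _ := Monoid.isComLaw.Build res r0 radd raddA raddC radd0.

Notation "\rsum_ ( i <- s ) F" := (\big[radd/r0]_(i <- s) F)
  (at level 41, F at level 41, i, s at level 50).

(* The increments bound the contents of the boxes on top of the maximum, so they
   may absorb it; hence the sum in the third clause, needed for [bang_incr]. *)
Definition rle (p q : res) : Prop :=
  forall k, [/\ rx p k <= rx q k, ri p k <= ri q k
              & ri p k + ry p k <= ri q k + ry q k].

Lemma rle_trans p q r : rle q p -> rle p r -> rle q r.
Proof. by move=> + + k => /(_ k)[? ? ?] /(_ k)[? ? ?]; split; lia. Qed.

Lemma rleD p p' q q' : rle p p' -> rle q q' -> rle (p +r q) (p' +r q').
Proof. by move=> + + k => /(_ k)[? ? ?] /(_ k)[? ? ?]; split=> /=; lia. Qed.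

Lemma rle_addr p q : rle p (p +r q).
Proof. by move=> k; split=> /=; lia. Qed.

Lemma rle_sum T (s : seq T) f g :
  (forall i, rle (f i) (g i)) -> rle (\rsum_(i <- s) f i) (\rsum_(i <- s) g i).
Proof.
move=> fg; elim: s => [|a s IH]; first by rewrite !big_nil.
by rewrite !big_cons; apply: rleD.
Qed.

Definition tick : res := Res (fun k => k == 0 : nat) (fun=> 0) (fun=> 0).
Definition open : res := Res (fun k => k == 1 : nat) (fun=> 0) (fun=> 0).
Definition time (r : res) : nat := rx r 0.

Definition flat (r : res) (k : nat) : nat := rx r k + ri r k + ry r k.

(* Index 0 of a resource counts steps, index [k.+1] is level [k]: going one level
   deeper leaves the steps in place. *)
Definition lv (k : nat) : nat := if k is j.+1 then j.+2 else 0.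

Definition shift (f : nat -> nat) (k : nat) : nat :=
  match k with 0 => f 0 | 1 => 0 | j.+2 => f j.+1 end.

Lemma shift_lv f k : shift f (lv k) = f k. Proof. by case: k. Qed.

(** [bang] is the cost of a duplicable argument: one opening at level 0, with contents one level
    deeper. [para] pays such contents exactly once, and [incr] adds them to every box. *)
Definition bang (r : res) : res :=
  Res (fun k => k == 1 : nat) (fun=> 0) (shift (flat r)).
Definition para (r : res) : res := Res (shift (flat r)) (fun=> 0) (fun=> 0).
Definition incr (r : res) : res := Res (fun=> 0) (shift (flat r)) (fun=> 0).

(** Each of the [rx r 1] openings runs a box of contents at most increment plus maximum. Level 0
    disappears, deeper levels move up by one and the steps stay at index 0. *)
Definition below (r : res) (k : nat) : nat :=
  rx r (lv k) + rx r 1 * (ri r (lv k) + ry r (lv k)).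

(** The same value serves as increment, with a zero maximum: increments may absorb contents in
    [rle], so [down (bang r)] dominates all three components of [r]. *)
Definition down (r : res) : res := Res (below r) (below r) (fun=> 0).

Lemma rle_down p q : rle p q -> rle (down p) (down q).
Proof.
move=> pq k; suff H : below p k <= below q k by rewrite /= !addn0.
have [? _ ?] := pq (lv k); have [? _ _] := pq 1.
by apply: leq_add => //; apply: leq_mul.
Qed.

(** In the sum, the openings of either summand meet contents that have only grown: the product of
    sums dominates the sum of products. *)
Lemma downD p q : rle (down p +r down q) (down (p +r q)).
Proof.
move=> k; suff H : below p k + below q k <= below (p +r q) k.
  by rewrite /= max0n !addn0.
rewrite /below /= mulnDl addnACA leq_add2l.
by apply: leq_add; apply: leq_mul; lia.
Qed.

Lemma down_sum T (s : seq T) f :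
  rle (\rsum_(i <- s) down (f i)) (down (\rsum_(i <- s) f i)).
Proof.
elim: s => [|a s IH]; first by rewrite !big_nil.
by rewrite !big_cons; apply: rle_trans (downD _ _); apply: rleD.
Qed.

Lemma down_bang r : rle r (down (bang r)).
Proof. by move=> k; rewrite /= /below /= shift_lv /flat; split; lia. Qed.

Lemma down_para r : rle r (down (para r)).
Proof. by move=> k; rewrite /= /below /= shift_lv /flat; split; lia. Qed.

Lemma down_tick r : rle (tick +r down r) (down (tick +r r)).
Proof.
move=> k; rewrite /= /below /=; case: k => [|k] /=; split; lia.
Qed.

Lemma shiftD f g k : shift (fun k => f k + g k) k = shift f k + shift g k.
Proof. by case: k => [|[|k]]. Qed.

Lemma leq_shift f g k : (forall k, f k <= g k) -> shift f k <= shift g k.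
Proof. by move=> fg; case: k => [|[|k]] /=. Qed.

(** Splits off the fixed cost [p] of a boxed argument as an increment, so that what remains is the
    box of a hypothesis. *)
Lemma bang_incr p q : rle (bang (p +r q)) (incr p +r bang q).
Proof.
move=> k; split=> //=; rewrite max0n add0n addn0 -shiftD.
by apply: leq_shift => j; rewrite /flat /=; lia.
Qed.

Lemma leq_time p q : rle p q -> time p <= time q.
Proof. by move=> /(_ 0)[]. Qed.

Lemma time_down r : time r <= time (down r).
Proof. by rewrite /time /= /below /=; lia. Qed.

Lemma rle_iter_down n p q : rle p q -> rle (iter n down p) (iter n down q).
Proof. by elim: n => //= n IH /IH; apply: rle_down. Qed.

Lemma iter_down_tick n r : rle (tick +r iter n down r) (iter n down (tick +r r)).
Proof.
elim: n => //= n IH; apply: rle_trans (down_tick _) _.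
exact: rle_down.
Qed.

Lemma time_iter_down m n r : m <= n -> time (iter m down r) <= time (iter n down r).
Proof.
move=> /subnK <-; elim: (n - m) => //= j IH.
exact: leq_trans IH (time_down _).
Qed.

(** * Bounded head reduction *)

(** The premises of [halts_if] all carry the same [k] instead of sharing it out, since an
    alternating path follows only one of them. Only beta steps and conditionals are counted. *)
Inductive halts : nat -> tm -> seq tm -> Prop :=
| halts_T k : halts k tmT [::]
| halts_F k : halts k tmF [::]
| halts_app k t u s : halts k t (u :: s) -> halts k (App t u) s
| halts_lam k t u s : halts k (inst t u) s -> halts k.+1 (Lam t) (u :: s)
| halts_if k t u v s :
    halts k t [::] -> halts k u s -> halts k v s -> halts k.+1 (If t u v) s.

Lemma halts_le k m t s : k <= m -> halts k t s -> halts m t s.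
Proof.
move=> le_km h; elim: h m le_km => {k t s}; try by constructor; auto.
- by move=> k t u s _ IH [//|m] /IH; constructor.
- by move=> k t u v s _ IHt _ IHu _ IHv [//|m] le_km; constructor; auto.
Qed.

Lemma halts_apps k t s s' : halts k (apps t s) s' <-> halts k t (s ++ s').
Proof.
elim: s t => //= u s IH t; rewrite IH; split=> [h|]; last by constructor.
by inversion h.
Qed.

Lemma halts_ev k t s : halts k t s -> exists b, ev t s b.
Proof.
elim=> {k t s}.
- by exists true; constructor.
- by exists false; constructor.
- by move=> k t u s _ [b ?]; exists b; constructor.
- by move=> k t u s _ [b ?]; exists b; constructor.
- move=> k t u v s _ [c hc] _ [b1 h1] _ [b2 h2].
  by exists (if c then b1 else b2); apply: (ev_if hc); case: c {hc}.
Qed.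

(** * Realizability *)

Definition cand := tm -> res -> Prop.

(** The number of executed levels is left open, so that a boolean under any number of paragraph
    modalities can be used as a test. *)
Definition halts_in (t : tm) (r : res) : Prop :=
  exists n, halts (time (iter n down r)) t [::].

Lemma halts_in_le t p q : rle p q -> halts_in t p -> halts_in t q.
Proof.
move=> pq [n h]; exists n; apply: halts_le h.
exact/leq_time/rle_iter_down.
Qed.

Lemma halts_in_down t p : halts_in t p -> halts_in t (down p).
Proof.
move=> [n h]; exists n; apply: halts_le h.
by rewrite -iterSr; apply: time_iter_down.
Qed.

(** Closure under head expansion at the price of one tick. In [sat_if] the test and both branches
    are charged to the same [p], as in a rule with a shared context. *)
Record saturated (X : cand) : Prop := Saturated {
  sat_le t p q : X t p -> rle p q -> X t q;
  sat_beta t u s p :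
    X (apps (inst t u) s) p -> X (apps (App (Lam t) u) s) (tick +r p);
  sat_if t u v s p :
    halts_in t p -> X (apps u s) p -> X (apps v s) p ->
    X (apps (If t u v) s) (tick +r p) }.

Definition vcons T (X : T) (e : nat -> T) (a : nat) : T :=
  if a is b.+1 then e b else X.

Fixpoint interp (e : nat -> cand) (A : ty) : cand :=
  match A with
  | TVar a => e a
  | Lin A B => fun t p =>
      forall u q, interp e A u q -> interp e B (App t u) (p +r q)
  | Arr A B => fun t p =>
      forall u q, interp e A u q -> interp e B (App t u) (p +r bang q)
  | Par A => fun t p => interp e A t (down p)
  | All A => fun t p =>
      forall X, saturated X -> interp (vcons X e) A t p
  | Bool => halts_in
  end.

Definition saturated_env (e : nat -> cand) := forall a, saturated (e a).

Lemma saturated_vcons X e :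
  saturated X -> saturated_env e -> saturated_env (vcons X e).
Proof. by move=> sX se [|a] /=. Qed.

Lemma saturated_halts_in : saturated halts_in.
Proof.
split=> [t p q h pq|t u s p [n h]|t u v s p [n ht] [n' hu] [n'' hv]].
- exact: halts_in_le h.
- exists n; apply: halts_le (leq_time (iter_down_tick n p)) _.
  by apply/halts_apps; do 2!constructor; apply/halts_apps.
pose m := maxn n (maxn n' n''); exists m.
apply: halts_le (leq_time (iter_down_tick m p)) _.
apply/halts_apps; constructor.
- by apply: halts_le ht; apply: time_iter_down; lia.
- by apply/halts_apps; apply: halts_le hu; apply: time_iter_down; lia.
- by apply/halts_apps; apply: halts_le hv; apply: time_iter_down; lia.
Qed.

Lemma saturated_interp e A : saturated_env e -> saturated (interp e A).
Proof.
elim: A e => [a|A IHA B IHB|A IHA B IHB|A IH|A IH|] e se /=.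
- exact: se.
- have [leB betaB ifB] := IHB e se.
  split=> [t p q h pq u r hu|t u s p h a r ha|t u v s p ht hu hv a r ha].
  + by apply: leB (h _ _ hu) _; apply: rleD.
  + by rewrite -apps_rcons -raddA; apply: betaB; rewrite apps_rcons; apply: h.
  + rewrite -apps_rcons -raddA; apply: ifB; rewrite ?apps_rcons; try by auto.
    exact: halts_in_le (rle_addr _ _) ht.
- have [leB betaB ifB] := IHB e se.
  split=> [t p q h pq u r hu|t u s p h a r ha|t u v s p ht hu hv a r ha].
  + by apply: leB (h _ _ hu) _; apply: rleD.
  + by rewrite -apps_rcons -raddA; apply: betaB; rewrite apps_rcons; apply: h.
  + rewrite -apps_rcons -raddA; apply: ifB; rewrite ?apps_rcons; try by auto.
    exact: halts_in_le (rle_addr _ _) ht.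
- have [leA betaA ifA] := IH e se.
  split=> [t p q h pq|t u s p h|t u v s p ht hu hv].
  + by apply: leA h _; apply: rle_down.
  (* Ticks sit at index 0, which the execution of a level preserves, so a head step under the
     modality still costs one tick. *)
  + by apply: leA (down_tick _); apply: betaA.
  + by apply: leA (down_tick _); apply: ifA => //; apply: halts_in_down.
- split=> [t p q h pq X sX|t u s p h X sX|t u v s p ht hu hv X sX];
    have [leA betaA ifA] := IH _ (saturated_vcons sX se).
  + exact: leA (h _ sX) _.
  + by apply: betaA; apply: h.
  + by apply: ifA => //; [apply: hu|apply: hv].
- exact: saturated_halts_in.
Qed.

Lemma forall_eq T (P Q : T -> Prop) : P =1 Q -> (forall x, P x) = (forall x, Q x).
Proof. by move=> /functional_extensionality->. Qed.

Lemma interp_tren e r A : interp e (tren r A) = interp (e \o r) A.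
Proof.
elim: A e r => //= [A IHA B IHB|A IHA B IHB|A IH|A IH] e r;
  rewrite ?IHA ?IHB ?IH //.
apply: functional_extensionality => t; apply: functional_extensionality => p.
apply: forall_eq => X; rewrite IH; congr (_ -> interp _ _ _ _).
by apply: functional_extensionality; case.
Qed.

Lemma interp_tsubst e s A :
  interp e (tsubst s A) = interp (fun a => interp e (s a)) A.
Proof.
elim: A e s => //= [A IHA B IHB|A IHA B IHB|A IH|A IH] e s;
  rewrite ?IHA ?IHB ?IH //.
apply: functional_extensionality => t; apply: functional_extensionality => p.
apply: forall_eq => X; rewrite IH; congr (_ -> interp _ _ _ _).
apply: functional_extensionality; case=> //= a; exact: interp_tren.
Qed.

Lemma vcons_bind T (X : T) (e : nat -> T) a : vcons X e \o bind a = upd e a X.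
Proof.
by apply: functional_extensionality => b /=; rewrite /bind /upd; case: eqP.
Qed.

Lemma interp_free e e' A :
  (forall a, tfree a A -> e a = e' a) -> interp e A = interp e' A.
Proof.
elim: A e e' => [a|A IHA B IHB|A IHA B IHB|A IH|A IH|] e e' E //=.
- by apply: E => /=.
- rewrite (IHA e e') ?(IHB e e') // => a fa; apply: E => /=; by rewrite fa ?orbT.
- rewrite (IHA e e') ?(IHB e e') // => a fa; apply: E => /=; by rewrite fa ?orbT.
- by rewrite (IH e e').
apply: functional_extensionality => t; apply: functional_extensionality => p.
apply: forall_eq => X; rewrite (IH _ (vcons X e')) //.
by case=> //= a fa; apply: E.
Qed.

(** * Soundness of the typing rules for realizability *)

Lemma deriv_wf G D t A : deriv G D t A -> wf G D.
Proof.
elim=> {G D t A} //=.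
- move=> G G' D D' t A GG' DD' _; rewrite /wf.
  have /perm_uniq -> // : perm_eq (unzip1 (G ++ D)) (unzip1 (G' ++ D')).
  exact/perm_map/perm_cat.
- move=> G D x t A B _; rewrite /wf /unzip1 !map_cat /= cat_uniq /=.
  rewrite cat_uniq => /and4P[-> /norP[_ /negPf hn] _ ->].
  by rewrite hn.
- by move=> G D x t A B _; rewrite /wf /= => /andP[].
- move=> G D t A _; rewrite /wf /unzip1 !map_cat /=.
  by rewrite /parctx -map_comp (eq_map (_ : _ =1 fst)).
Qed.

Definition supp (D : nat) (r : res) : Prop :=
  forall k, D < k -> [/\ rx r k = 0, ri r k = 0 & ry r k = 0].

Lemma supp_le D D' r : D <= D' -> supp D r -> supp D' r.
Proof. by move=> DD' s k /(leq_ltn_trans DD')/s. Qed.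

Lemma suppD D r r' : supp D r -> supp D r' -> supp D (r +r r').
Proof. by move=> s s' k /= Dk; case: (s _ Dk) (s' _ Dk) => -> -> -> [-> -> ->]. Qed.

Lemma supp_shift D r k : supp D r -> D.+1 < k -> shift (flat r) k = 0.
Proof.
case: k => [|[|k]] //= s; rewrite ltnS => /s; rewrite /flat.
by case=> -> -> ->.
Qed.

Lemma supp_para D r : supp D r -> supp D.+1 (para r).
Proof. by move=> s k Dk; rewrite /= (supp_shift s). Qed.

Lemma supp_incr D r : supp D r -> supp D.+1 (incr r).
Proof. by move=> s k Dk; rewrite /= (supp_shift s). Qed.

Lemma supp_bang D r : supp D r -> supp D.+1 (bang r).
Proof. by move=> s k Dk; rewrite /= (supp_shift s) //; case: k Dk => [|[]]. Qed.

Lemma supp_tick D : supp D tick. Proof. by case. Qed.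

Lemma supp_open D : supp D.+1 open. Proof. by case=> [|[]]. Qed.

(** A linear hypothesis is paid directly, a non-linear one as a box that can be opened once. *)
Definition ctxr (q : nat -> res) (G D : ctx) : res :=
  (\rsum_(p <- G) bang (q p.1)) +r (\rsum_(p <- D) q p.1).

Definition realized (e : nat -> cand) (s : nat -> tm) (q : nat -> res) (G : ctx) :=
  forall p, p \in G -> interp e p.2 (s p.1) (q p.1).

Lemma realized_cat e s q G D :
  realized e s q (G ++ D) <-> realized e s q G /\ realized e s q D.
Proof.
split=> [h|[hG hD] p]; last by rewrite mem_cat => /orP[/hG|/hD].
by split=> p pG; apply: h; rewrite mem_cat pG ?orbT.
Qed.

Lemma realized_cons e s q x A G :
  realized e s q ((x, A) :: G) <-> interp e A (s x) (q x) /\ realized e s q G.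
Proof.
split=> [h|[hx hG] p]; last by rewrite inE => /predU1P[->|/hG].
split=> [|p pG]; first by apply: (h (x, A)); rewrite inE eqxx.
by apply: h; rewrite inE pG orbT.
Qed.

Lemma updx T (f : nat -> T) x v : upd f x v x = v.
Proof. by rewrite /upd eqxx. Qed.

Lemma upd_notin T (f : nat -> T) x v (G : ctx) p :
  x \notin unzip1 G -> p \in G -> upd f x v p.1 = f p.1.
Proof.
move=> xG pG; rewrite /upd; case: eqP => // px.
by move: xG; rewrite -px (map_f fst pG).
Qed.

Lemma realized_upd e s q x u r G :
  x \notin unzip1 G -> realized e s q G ->
  realized e (upd s x u) (upd q x r) G.
Proof. by move=> xG h p pG; rewrite !(upd_notin _ _ xG pG); apply: h. Qed.

Lemma rsum_upd (f : res -> res) q x r (G : ctx) :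
  x \notin unzip1 G ->
  \rsum_(p <- G) f (upd q x r p.1) = \rsum_(p <- G) f (q p.1).
Proof. by move=> xG; apply: eq_big_seq => p pG; rewrite (upd_notin _ _ xG pG). Qed.

Lemma ctxr_cat q G1 G2 D1 D2 :
  ctxr q (G1 ++ G2) (D1 ++ D2) = ctxr q G1 D1 +r ctxr q G2 D2.
Proof. by rewrite /ctxr !big_cat /= Monoid.mulmACA. Qed.

Lemma interp_iter_par e k t p :
  interp e (iter k Par Bool) t p -> halts_in t p.
Proof.
have -> : interp e (iter k Par Bool) t p = halts_in t (iter k down p).
  by elim: k p => //= k IH p; rewrite IH -iterSr.
by case=> n h; exists (n + k); rewrite iterD.
Qed.

Ltac rlia := let k := fresh in move=> k /=; split; lia.

(** The constant [c] is uniform in the environment, the substitution and the resources of the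
    hypotheses. Depth [D] gives the levels 0 to [D], that is, indices up to [D.+1]. *)
Definition sound (D : nat) (G L : ctx) (t : tm) (A : ty) : Prop :=
  exists2 c, supp D.+1 c &
    forall e s q, saturated_env e -> realized e s q G -> realized e s q L ->
      interp e A (subst s t) (c +r ctxr q G L).

(** One argument for both arrows: [f] is the identity for the linear one and [bang] for the other.
    The added tick pays for the beta step. *)
Lemma sound_lam x t A B (G D G' D' : ctx) d (f : res -> res) C :
  x \notin unzip1 G -> x \notin unzip1 D ->
  (forall e s q, realized e s q G' /\ realized e s q D' <->
     [/\ interp e A (s x) (q x), realized e s q G & realized e s q D]) ->
  (forall q, rle (ctxr q G' D') (f (q x) +r ctxr q G D)) ->
  (forall e t p, interp e C t p =
     forall u q, interp e A u q -> interp e B (App t u) (p +r f q)) ->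
  sound d G' D' t B -> sound d G D (lam x t) C.
Proof.
move=> xG xD hctx hres hC [c sc h]; exists (tick +r c).
  by apply: suppD => //; apply: supp_tick.
move=> e s q se hG hD; rewrite subst_lam hC => u r hu.
have sB := saturated_interp B se.
have [_ hctx'] := hctx e (upd s x u) (upd q x r).
have [|hG' hD'] := hctx'; first by rewrite !updx; split=> //; apply: realized_upd.
have {}h := h _ _ _ se hG' hD'.
rewrite -inst_subst_lam in h.
apply: sat_le (sat_beta sB (s := [::]) h) _ => //.
have := hres (upd q x r); rewrite updx /ctxr !(rsum_upd _ _ _ xG) !(rsum_upd id _ _ xD).
move=> H k; have [H1 H2 H3] := H k; move: H1 H2 H3 => /=; split; lia.
Qed.

Lemma sound_le d d' G D t A : d <= d' -> sound d G D t A -> sound d' G D t A.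
Proof. by move=> le_d [c sc h]; exists c => //; apply: supp_le sc. Qed.

Lemma sound_line d G1 G2 D1 D2 t u A B :
  sound d G1 D1 t (Lin A B) -> sound d G2 D2 u A ->
  sound d (G1 ++ G2) (D1 ++ D2) (App t u) B.
Proof.
move=> [c sc ht] [c' sc' hu]; exists (c +r c'); first exact: suppD.
move=> e s q se /realized_cat[hG1 hG2] /realized_cat[hD1 hD2].
rewrite ctxr_cat Monoid.mulmACA.
exact: (ht e s q se hG1 hD1 _ _ (hu e s q se hG2 hD2)).
Qed.

(** The argument is a box holding its own constant [c'] and the resource of [z]. By [bang_incr] the
    constant becomes an increment one level deeper, and the box of [z] is the one counted in the
    context of the conclusion. *)
Lemma sound_arre d G D z C t u A B :
  sound d.+1 G D t (Arr A B) -> sound d [::] [:: (z, C)] u A ->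
  sound d.+1 ((z, C) :: G) D (App t u) B.
Proof.
move=> [c sc ht] [c' sc' hu]; exists (c +r incr c').
  by apply: suppD => //; apply: supp_incr.
move=> e s q se /realized_cons[hz hG] hD.
have hu' : interp e A (subst s u) (c' +r q z).
  have: interp e A (subst s u) (c' +r ctxr q [::] [:: (z, C)]).
    by apply: hu => //; apply/realized_cons; split.
  by rewrite /ctxr big_nil big_seq1 Monoid.mul1m.
apply: sat_le (saturated_interp B se) _ _ _ (ht e s q se hG hD _ _ hu') _.
have := bang_incr c' (q z); rewrite /ctxr big_cons /=.
move=> H k; have [H1 H2 H3] := H k; move: H1 H2 H3 => /=; split; lia.
Qed.

Lemma sound_arre0 d G D t u A B :
  sound d.+1 G D t (Arr A B) -> sound d [::] [::] u A ->
  sound d.+1 G D (App t u) B.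
Proof.
move=> [c sc ht] [c' sc' hu]; exists (c +r bang c').
  by apply: suppD => //; apply: supp_bang.
move=> e s q se hG hD.
have hu' : interp e A (subst s u) c'.
  have: interp e A (subst s u) (c' +r ctxr q [::] [::]) by apply: hu.
  by rewrite /ctxr !big_nil !Monoid.mulm1.
apply: sat_le (saturated_interp B se) _ _ _ (ht e s q se hG hD _ _ hu') _.
rlia.
Qed.

(** Two boxes with equal contents have the same maximum as one, so identifying the variables costs a
    single further opening, whatever the contents. *)
Lemma sound_cntr d G D x x1 x2 t A B :
  wf ((x1, A) :: (x2, A) :: G) D ->
  sound d ((x1, A) :: (x2, A) :: G) D t B ->
  sound d ((x, A) :: G) D
    (ren (fun y => if (y == x1) || (y == x2) then x else y) t) B.
Proof.
set f := fun y => _.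
rewrite /wf /= inE negb_or => /and3P[/andP[_ x1n] x2n _] [c sc h].
exists (c +r open); first by apply: suppD => //; apply: supp_open.
move=> e s q se /realized_cons[hx hG] hD; rewrite subst_ren.
have fid p : p \in G ++ D -> f p.1 = p.1.
  move=> pGD; rewrite /f; case: ifP => // /orP[/eqP px|/eqP px].
    by move: x1n; rewrite -px (map_f fst pGD).
  by move: x2n; rewrite -px (map_f fst pGD).
have fx1 : f x1 = x by rewrite /f eqxx.
have fx2 : f x2 = x by rewrite /f eqxx orbT.
have hG' : realized e (s \o f) (q \o f) ((x1, A) :: (x2, A) :: G).
  apply/realized_cons; rewrite /= fx1; split=> //.
  apply/realized_cons; rewrite /= fx2; split=> // p pG.
  by rewrite /= fid ?mem_cat ?pG //; apply: hG.
have hD' : realized e (s \o f) (q \o f) D.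
  by move=> p pD; rewrite /= fid ?mem_cat ?pD ?orbT //; apply: hD.
apply: sat_le (saturated_interp B se) _ _ _ (h _ _ _ se hG' hD') _.
rewrite /ctxr !big_cons /= fx1 fx2.
have -> : \rsum_(p <- G) bang (q (f p.1)) = \rsum_(p <- G) bang (q p.1).
  by apply: eq_big_seq => p pG; rewrite fid ?mem_cat ?pG.
have -> : \rsum_(p <- D) q (f p.1) = \rsum_(p <- D) q p.1.
  by apply: eq_big_seq => p pD; rewrite fid ?mem_cat ?pD ?orbT.
rlia.
Qed.

Lemma sound_pari d G D t A :
  wf G D -> sound d [::] (G ++ D) t A -> sound d.+1 G (parctx D) t (Par A).
Proof.
rewrite /wf /unzip1 map_cat cat_uniq => /and3P[_ /hasPn GD _] [c sc h].
exists (para c); first exact: supp_para.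
move=> e s q se hG hD.
(* A realizer of a hypothesis of type [Par A] with resource [q x] is a realizer of [A] with resource
   [down (q x)]; the variables of [G] keep their type and their resource. *)
pose q' x := if x \in unzip1 D then down (q x) else q x.
have q'D p : p \in D -> q' p.1 = down (q p.1) by move=> pD; rewrite /q' map_f.
have q'G p : p \in G -> q' p.1 = q p.1.
  move=> pG; rewrite /q'; case: ifP => // /GD.
  by rewrite map_f.
have hGD : realized e s q' (G ++ D).
  apply/realized_cat; split=> p pG; first by rewrite q'G //; apply: hG.
  by rewrite q'D //; apply: (hD (p.1, Par p.2)); apply/mapP; exists p.
have {}h : interp e A (subst s t) (c +r ctxr q' [::] (G ++ D)) by apply: h.
apply: sat_le (saturated_interp A se) _ _ _ h _.
rewrite /ctxr big_nil Monoid.mul1m big_cat /=.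
rewrite (eq_big_seq _ q'G) (eq_big_seq _ q'D) /parctx big_map /=.
(* Each summand lies below the [down] of its counterpart in the conclusion, and superadditivity
   joins these into one [down]. *)
apply: rle_trans (downD _ _); apply: rleD; first exact: down_para.
apply: rle_trans (downD _ _); apply: rleD; last exact: down_sum.
apply: rle_trans (down_sum _ _); apply: rle_sum => p; exact: down_bang.
Qed.

(** The realizer of [u] replaces [x] at the same type [Par A]; no level is executed and only the
    constants add up. *)
Lemma sound_pare d G1 G2 D1 D2 x t u A B :
  wf G2 ((x, Par A) :: D2) ->
  sound d G1 D1 u (Par A) -> sound d G2 ((x, Par A) :: D2) t B ->
  sound d (G1 ++ G2) (D1 ++ D2) (sub x u t) B.
Proof.
rewrite /wf /unzip1 map_cat cat_uniq /= => /and3P[_ /norP[xG _] /andP[xD _]].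
move=> [c sc hu] [c' sc' ht]; exists (c +r c'); first exact: suppD.
move=> e s q se /realized_cat[hG1 hG2] /realized_cat[hD1 hD2].
rewrite subst_sub ctxr_cat.
have {}hu := hu e s q se hG1 hD1.
have hG : realized e (upd s x (subst s u)) (upd q x (c +r ctxr q G1 D1)) G2.
  exact: realized_upd.
have hD : realized e (upd s x (subst s u)) (upd q x (c +r ctxr q G1 D1))
            ((x, Par A) :: D2).
  by apply/realized_cons; rewrite !updx; split=> //; apply: realized_upd.
apply: sat_le (saturated_interp B se) _ _ _ (ht _ _ _ se hG hD) _.
rewrite /ctxr big_cons updx !(rsum_upd _ _ _ xG) (rsum_upd id _ _ xD) /ctxr.
rlia.
Qed.

Lemma saturated_upd e a X :
  saturated X -> saturated_env e -> saturated_env (upd e a X).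
Proof. by move=> sX se b; rewrite /upd; case: eqP. Qed.

Lemma interp_tall e a A t p :
  interp e (tall a A) t p =
  (forall X, saturated X -> interp (upd e a X) A t p).
Proof.
apply: forall_eq => X; by rewrite -vcons_bind -interp_tren.
Qed.

Lemma sound_alli d G D a t A :
  tfresh a (G ++ D) -> sound d G D t A -> sound d G D t (tall a A).
Proof.
move=> /allP fr [c sc h]; exists c => // e s q se hG hD.
rewrite interp_tall => X sX.
have free_eq p : p \in G ++ D -> interp (upd e a X) p.2 = interp e p.2.
  move=> /fr fp; apply: interp_free => b fb; rewrite /upd; case: eqP => // ba.
  by move: fp; rewrite -ba fb.
apply: h; first exact: saturated_upd.
  by move=> p pG; rewrite free_eq ?mem_cat ?pG //; apply: hG.
by move=> p pD; rewrite free_eq ?mem_cat ?pD ?orbT //; apply: hD.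
Qed.

Lemma sound_alle d G D a t A B :
  sound d G D t (tall a A) -> sound d G D t (tsub a B A).
Proof.
move=> [c sc h]; exists c => // e s q se hG hD.
have := h e s q se hG hD; rewrite interp_tall => /(_ _ (saturated_interp B se)).
rewrite /tsub interp_tsubst.
suff -> : upd e a (interp e B) =
          (fun b => interp e (if b == a then B else TVar b)) by [].
by apply: functional_extensionality => b; rewrite /upd; case: eqP.
Qed.

(** The constants of the premises are added, but the resource of the context is counted once,
    because [sat_if] charges the test and the branches to the same resource. *)
Lemma sound_if d G D k t u v A :
  sound d G D t (iter k Par Bool) -> sound d G D u A -> sound d G D v A ->
  sound d G D (If t u v) A.
Proof.
move=> [c sc ht] [c1 sc1 hu] [c2 sc2 hv].
exists (tick +r (c +r c1 +r c2)).
  exact (suppD (@supp_tick d.+1) (suppD (suppD sc sc1) sc2)).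
move=> e s q se hG hD; rewrite -raddA.
have leA := sat_le (saturated_interp A se).
apply: (sat_if (saturated_interp A se) (s := [::])) => /=.
- have := interp_iter_par (ht e s q se hG hD); apply: halts_in_le; rlia.
- apply: leA (hu e s q se hG hD) _; rlia.
- apply: leA (hv e s q se hG hD) _; rlia.
Qed.

Theorem soundness G D t A (p : deriv G D t A) : sound (depth p) G D t A.
Proof.
elim: p => {G D t A} /=.
- move=> G G' D D' t A GG' DD' pr [c sc h]; exists c => // e s q se hG hD.
  have -> : ctxr q G' D' = ctxr q G D.
    by rewrite /ctxr; congr (_ +r _); apply: perm_big; rewrite perm_sym.
  apply: h => // p pin; first by apply: hG; rewrite -(perm_mem GG').
  by apply: hD; rewrite -(perm_mem DD').
- move=> x A; exists r0 => // e s q se _ /realized_cons[hx _].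
  by rewrite /ctxr big_nil big_seq1 !Monoid.mul1m.
- move=> G D x t A B p; have := deriv_wf p.
  rewrite /wf /unzip1 map_cat cat_uniq /= => /and3P[_ /norP[xG _] /andP[xD _]].
  apply: (sound_lam (A := A) (B := B) (f := id) xG xD) => //.
    move=> e s q; rewrite realized_cons; split=> [[hG []]|[]] //.
  by move=> q; rewrite /ctxr big_cons; rlia.
- move=> G1 G2 D1 D2 t u A B _ p1 IH1 p2 IH2.
  apply: (@sound_line _ _ _ _ _ _ _ A); first exact: sound_le (leq_maxl _ _) IH1.
  exact: sound_le (leq_maxr _ _) IH2.
- move=> G D x t A B p; have := deriv_wf p.
  rewrite /wf /= /unzip1 map_cat mem_cat => /andP[/norP[xG xD] _].
  apply: (sound_lam (A := A) (B := B) (f := bang) xG xD) => //.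
    move=> e s q; rewrite realized_cons; split=> [[[]]|[]] //.
  by move=> q; rewrite /ctxr big_cons; rlia.
- move=> G D z C t u A B _ p1 IH1 p2 IH2.
  (* This rule has positive depth, which leaves room for the constant of the argument one level
     deeper. *)
  have [d dE] : {d | maxn (depth p1) (depth p2).+1 = d.+1}.
    by exists (maxn (depth p1) (depth p2).+1).-1; lia.
  rewrite dE; apply: (@sound_arre d _ _ _ _ _ _ A).
    by apply: sound_le IH1; lia.
  by apply: sound_le IH2; lia.
- move=> G D t u A B p1 IH1 p2 IH2.
  have [d dE] : {d | maxn (depth p1) (depth p2).+1 = d.+1}.
    by exists (maxn (depth p1) (depth p2).+1).-1; lia.
  rewrite dE; apply: (@sound_arre0 d _ _ _ _ A).
    by apply: sound_le IH1; lia.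
  by apply: sound_le IH2; lia.
- move=> G1 G2 D1 D2 t A _ p [c sc h]; exists c => // e s q se.
  move=> /realized_cat[hG1 hG2] /realized_cat[hD1 hD2].
  apply: sat_le (saturated_interp A se) _ _ _ (h e s q se hG1 hD1) _.
  by rewrite ctxr_cat; rlia.
- move=> G D x x1 x2 t A B _ p; exact: sound_cntr (deriv_wf p).
- move=> G D t A p; apply: sound_pari; have := deriv_wf p.
  by rewrite /wf.
- move=> G1 G2 D1 D2 x t u A B _ p1 IH1 p2 IH2.
  apply: (sound_pare (deriv_wf p2)); first exact: sound_le (leq_maxl _ _) IH1.
  exact: sound_le (leq_maxr _ _) IH2.
- by move=> G D a t A fr p; apply: sound_alli.
- by move=> G D a t A B p; apply: sound_alle.
- by exists r0 => //= *; exists 0; constructor.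
- by exists r0 => //= *; exists 0; constructor.
- move=> G D k t u v A p1 IH1 p2 IH2 p3 IH3.
  by apply: (@sound_if _ _ _ k); [apply: sound_le IH1|apply: sound_le IH2|
    apply: sound_le IH3]; lia.
Qed.

(** * Words *)

Definition nilc : tm := Lam (Lam (Lam (Var 0))).

(** An open code whose free variable, [Var 3] under the binders, is the tail. The function for
    letter 0 is bound outermost, hence has index 2. *)
Definition consc (b : bool) : tm :=
  Lam (Lam (Lam (App (Var (if b then 1 else 2))
    (App (App (App (Var 3) (Var 2)) (Var 1)) (Var 0))))).

(* The closure chain of the heap, decoded; unlike [church w], it is built from
   finitely many codes. *)
Fixpoint chu (w : word) : tm :=
  if w is b :: w' then subst (nth (Var 0) [:: chu w']) (consc b) else nilc.

Lemma closed_chu w : closed_tm (chu w).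
Proof.
elim: w => [|b w IH] // x.
have IHx := negbTE (IH x.+3).
by case: b; rewrite /= !closed_ren //= IHx.
Qed.

Lemma chu_cons b w :
  chu (b :: w) = Lam (Lam (Lam (App (Var (if b then 1 else 2))
    (App (App (App (chu w) (Var 2)) (Var 1)) (Var 0))))).
Proof.
by have c := closed_chu w; case: b; rewrite /= !closed_ren.
Qed.

Definition body (w : word) : tm :=
  foldr (fun (i : bool) u => App (Var (if i then 1 else 2)) u) (Var 0) w.

Lemma churchE w : church w = Lam (Lam (Lam (body w))).
Proof.
rewrite /church /lam /=; do 3!congr Lam.
by elim: w => //= -[] w ->.
Qed.

Lemma inst_scons t u : inst t u = subst (scons u Var) t.
Proof. by apply: eq_subst; case. Qed.

Lemma inst_lam2 b u0 u1 u2 :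
  [/\ inst (Lam (Lam b)) u0 = Lam (Lam (subst (ups (ups (scons u0 Var))) b)),
      inst (Lam (subst (ups (ups (scons u0 Var))) b)) u1 =
        Lam (subst (ups (scons u1 (scons u0 Var))) b)
    & inst (subst (ups (scons u1 (scons u0 Var))) b) u2 =
        subst (scons u2 (scons u1 (scons u0 Var))) b].
Proof.
split; rewrite ?inst_ups // inst_scons //.
by rewrite -inst_scons (inst_ups _ (Lam b)).
Qed.

Lemma sat_beta3 X b u0 u1 u2 p :
  saturated X -> X (subst (scons u2 (scons u1 (scons u0 Var))) b) p ->
  X (App (App (App (Lam (Lam (Lam b))) u0) u1) u2) (tick +r (tick +r (tick +r p))).
Proof.
move=> sX h; have [e0 e1 e2] := inst_lam2 b u0 u1 u2.
apply: (sat_beta sX (s := [:: u1; u2])); rewrite /= e0.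
apply: (sat_beta sX (s := [:: u2])); rewrite /= e1.
by apply: (sat_beta sX (s := [::])); rewrite /= e2.
Qed.

Lemma reds_beta3 b u0 u1 u2 :
  reds (App (App (App (Lam (Lam (Lam b))) u0) u1) u2)
       (subst (scons u2 (scons u1 (scons u0 Var))) b).
Proof.
have [e0 e1 e2] := inst_lam2 b u0 u1 u2.
apply: (rt_trans _ _ _
  (App (App (Lam (Lam (subst (ups (ups (scons u0 Var))) b))) u1) u2)).
  by rewrite -e0; apply: rt_step; do 3!constructor.
apply: (rt_trans _ _ _ (App (Lam (subst (ups (scons u1 (scons u0 Var))) b)) u2)).
  by rewrite -e1; apply: rt_step; do 3!constructor.
by rewrite -e2; apply: rt_step; constructor.
Qed.

Lemma reds_chu w : reds (chu w) (church w).
Proof.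
rewrite churchE; elim: w => [|b w IH]; first exact: rt_refl.
rewrite chu_cons /=; do 3!apply: reds_lam; apply: reds_app; first exact: rt_refl.
apply: rt_trans (reds_app (reds_app (reds_app IH _) _) _) _; try exact: rt_refl.
apply: rt_trans (reds_beta3 _ _ _ _) _.
suff -> : subst (scons (Var 0) (scons (Var 1) (scons (Var 2) Var))) (body w) = body w.
  exact: rt_refl.
by elim: (w) => //= -[] v ->.
Qed.

(** Three beta steps for each letter and for the end of the chain. There are two openings per letter
    because the estimate charges every letter with both step functions. *)
Definition cw (n : nat) : res :=
  Res (fun k => match k with 0 => 3 * n.+1 | 1 => 2 * n | _ => 0 end)
      (fun=> 0) (fun=> 0).

(** Flattening [Q] moves its maximum into an increment, after which [n] copies cost [n] times as
    much in each component. *)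
Lemma iter_radd_le n Q r :
  rle (iter n (radd Q) r)
      (Res (fun k => n * flat Q k) (fun k => n * flat Q k) (fun=> 0) +r r).
Proof.
elim: n => [|n IH] k; first by split=> /=; lia.
by case: (IH k); rewrite /= /flat; split; lia.
Qed.

Lemma realizes_chu e w : saturated_env e -> interp e tyW (chu w) (cw (size w)).
Proof.
rewrite interp_tall => se X sX f0 q0 h0 f1 q1 h1 a r ha.
change (X (App (App (App (chu w) f0) f1) a)
  (down (cw (size w) +r bang q0 +r bang q1) +r r)).
(* The cost of one letter: its three beta steps and, as an upper bound, both step functions. *)
pose Q := tick +r (tick +r (tick +r (q0 +r q1))).
have H : X (App (App (App (chu w) f0) f1) a)
    (iter (size w) (radd Q) (tick +r (tick +r (tick +r r)))).
  elim: w => [|b w IH]; first exact: sat_beta3.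
  rewrite chu_cons -/(size _) /=.
  set p := iter _ _ _ in IH *.
  suff h : X (subst (scons a (scons f1 (scons f0 Var)))
      (App (Var (if b then 1 else 2))
         (App (App (App (chu w) (Var 2)) (Var 1)) (Var 0)))) ((q0 +r q1) +r p).
    have := sat_beta3 sX h; rewrite /Q !raddA; exact.
  rewrite /= closed_subst; last exact: closed_chu.
  case: b => /=.
    apply: (sat_le sX) (h1 _ _ IH) _; rlia.
  apply: (sat_le sX) (h0 _ _ IH) _; rlia.
apply: (sat_le sX H); apply: rle_trans (iter_radd_le _ _ _) _.
move=> k; rewrite /= /below /= !shift_lv /flat /=.
set n := size w; set x0 := rx q0 k; set x1 := rx q1 k; set i0 := ri q0 k.
set i1 := ri q1 k; set y0 := ry q0 k; set y1 := ry q1 k.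
set s0 := x0 + i0 + y0; set s1 := x1 + i1 + y1.
(* Both contents together are at most twice the larger one. The openings available are the [2 * n]
   of the word and one from each of the two boxes. *)
have M : n * (x0 + x1 + (i0 + i1) + maxn y0 y1) <=
   (2 * n + 1 + 1) * maxn s0 s1.
  have : n * (x0 + x1 + (i0 + i1) + maxn y0 y1) <= n * (2 * maxn s0 s1).
    by rewrite leq_mul2l; apply/orP; right; rewrite /s0 /s1; lia.
  by move/leq_trans; apply; rewrite mulnA (mulnC n) leq_mul2r; apply/orP; right; lia.
case: k @x0 @x1 @i0 @i1 @y0 @y1 @s0 @s1 M => [|k] x0 x1 i0 i1 y0 y1 s0 s1 M /=;
  rewrite !(add0n, addn0) ?max0n ?addn0 -/s0 -/s1; split; nia.
Qed.

(** * Polynomial bound on head reduction *)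

Definition rbounded (B : nat) (r : res) : Prop :=
  forall k, [/\ rx r k <= B, ri r k <= B & ry r k <= B].

Lemma supp_down D r : supp D.+1 r -> supp D (down r).
Proof.
move=> s [|k] // Dk; rewrite /= /below /=.
by have [|-> -> ->] := s k.+2; rewrite ?muln0.
Qed.

Lemma supp0_down r B : supp 0 r -> rbounded B r -> rbounded B (down r).
Proof.
move=> s b k; have [x1 _ _] := s 1 isT; rewrite /= /below x1 mul0n addn0.
by have [? _ _] := b (lv k); split.
Qed.

Lemma rbounded_down B r : 0 < B -> rbounded B r -> rbounded (3 * B ^ 2) (down r).
Proof.
move=> B0 b k; suff H : below r k <= 3 * B ^ 2 by [].
have [? ? ?] := b (lv k); have [? _ _] := b 1.
have : rx r 1 * (ri r (lv k) + ry r (lv k)) <= B * (2 * B).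
  by apply: leq_mul => //; lia.
by rewrite /below -mulnn; nia.
Qed.

(** Executing a level lowers the support by one and turns the bound [B] into [3 * B ^ 2], so [3 * B]
    is squared exactly, at most [D] times. Once only index 0 is left, further executions preserve
    the bound. *)
Lemma time_iter_down_le D B r n :
  0 < B -> supp D r -> rbounded B r -> time (iter n down r) <= (3 * B) ^ 2 ^ D.
Proof.
elim: D B r n => [|D IH] B r n B0 s b.
  have : time (iter n down r) <= B.
    elim: n r s b => [|n IHn] r s b; first by case: (b 0).
    rewrite iterSr; apply: IHn; last exact: supp0_down.
    by apply: supp_down => k k1; apply: s; apply: ltn_trans k1.
  by rewrite expn0 expn1; lia.
have BB : B <= B ^ 2 by rewrite -mulnn leq_pmulr.
have -> : (3 * B) ^ 2 ^ D.+1 = (3 * (3 * B ^ 2)) ^ 2 ^ D.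
  by rewrite expnS expnM; congr (_ ^ _); rewrite -!mulnn; lia.
case: n => [|n].
  apply: leq_trans (_ : B <= _); first by case: (b 0).
  apply: leq_trans (_ : 3 * (3 * B ^ 2) <= _); first lia.
  by rewrite -{1}[3 * _]expn1 leq_pexp2l ?expn_gt0 //; lia.
rewrite iterSr; apply: IH; last exact: rbounded_down.
  by lia.
exact: supp_down.
Qed.

Lemma supp_rbounded D r : supp D r -> exists B, rbounded B r.
Proof.
move=> s; exists (\sum_(k < D.+1) flat r k) => k.
case: (leqP k D) => [kD|/s[-> -> ->] //].
rewrite (bigD1 (Ordinal (kD : k < D.+1))) //= /flat; split; lia.
Qed.

Theorem typed_halts t n d :
  closed_tm t ->
  has_deriv_of_depth d [::] [::] t (Arr tyW (iter n Par Bool)) \/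
  has_deriv_of_depth d [::] [::] t (Lin tyW (iter n Par Bool)) ->
  exists C, forall w,
    halts ((C * (size w).+1) ^ (4 * 2 ^ d)) (App t (chu w)) [::].
Proof.
move=> ct ht.
have se : saturated_env (fun=> halts_in) by move=> a; exact: saturated_halts_in.
(* The word contributes [cw] or its box, according to the arrow. A box reaches index 2, so the total
   is supported up to [d.+2], whence the exponent [2 ^ d.+2]. *)
have [c sc h] : exists2 c, supp d.+1 c & forall w, exists2 r,
    halts_in (App t (chu w)) (c +r r) & supp 2 r /\ rbounded (3 * (size w).+1) r.
  case: ht => -[p dp]; have [c sc h] := soundness p; rewrite dp in sc.
  - exists c => // w; have := h _ Var (fun=> r0) se.
    rewrite closed_subst // /ctxr !big_nil !Monoid.mulm1 => h'.
    have {}h' := h' _ _ _ _ (realizes_chu w se).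
    exists (bang (cw (size w))); first by apply: interp_iter_par (h' _ _).
    by split=> -[|[|[|k]]] //=; rewrite /flat /=; split; lia.
  - exists c => // w; have := h _ Var (fun=> r0) se.
    rewrite closed_subst // /ctxr !big_nil !Monoid.mulm1 => h'.
    have {}h' := h' _ _ _ _ (realizes_chu w se).
    exists (cw (size w)); first by apply: interp_iter_par (h' _ _).
    by split=> -[|[|[|k]]] //=; split; lia.
have [B hB] := supp_rbounded sc.
exists (3 * (B + 3)) => w; have [r [m hr] [sr br]] := h w.
apply: halts_le hr; have -> : 4 * 2 ^ d = 2 ^ d.+2 by rewrite !expnS; lia.
apply: leq_trans (time_iter_down_le (B := B + 3 * (size w).+1) (D := d.+2) _ _ _ _) _.
- by lia.
- by apply: suppD; [apply: supp_le sc|apply: supp_le sr].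
- move=> k; have [? ? ?] := hB k; have [? ? ?] := br k; split=> /=; lia.
- by rewrite leq_exp2r ?expn_gt0 //; nia.
Qed.

(** * Alternating stack programs *)

(** Input, heap, buffer for scanning the heap, environment pointer, temporary, heap size, argument
    stack, current code and guessed value. *)
Inductive reg := RIn | RH | RB | RE | RT | RK | RS | RC | RG.

Lemma reg_eq_dec (a b : reg) : decidable (a = b).
Proof. by rewrite /decidable; decide equality. Defined.

HB.instance Definition _ := hasDecEq.Build reg (compareP reg_eq_dec).

Definition reg_num (r : reg) : nat :=
  match r with
  | RIn => 0 | RH => 1 | RB => 2 | RE => 3 | RT => 4 | RK => 5 | RS => 6
  | RC => 7 | RG => 8
  end.

Lemma reg_num_lt r : reg_num r < 9. Proof. by case: r. Qed.

Definition ord_of (r : reg) : 'I_9 := Ordinal (reg_num_lt r).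

Definition reg_of (i : 'I_9) : reg :=
  nth RIn [:: RIn; RH; RB; RE; RT; RK; RS; RC; RG] i.

Lemma ord_ofK : cancel ord_of reg_of. Proof. by case. Qed.

Lemma reg_ofK : cancel reg_of ord_of.
Proof. by move=> i; apply: val_inj; case: i; do 9?[case=> //]. Qed.

Section Language.
Variables (S : finType) (blank : S).

Inductive cmd :=
| Up (a : reg)
| Pop (a : reg)
| SetC (a : reg) (x : S)
| SetT (a b : reg)
| Seq (c1 c2 : cmd)
| While (a : reg) (x : S) (p : bool) (c : cmd)
| Ifc (a : reg) (x : S) (c1 c2 : cmd)
| Or (c1 c2 : cmd)
| And (c1 c2 : cmd)
| Halt (b : bool).

Lemma cmd_eq_dec (c c' : cmd) : decidable (c = c').
Proof. by rewrite /decidable; decide equality; apply: eq_comparable. Defined.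

HB.instance Definition _ := hasDecEq.Build cmd (compareP cmd_eq_dec).

Definition store := reg -> seq S.

Definition top_sym (st : store) (a : reg) : S := head blank (st a).

Definition setr (st : store) (a : reg) (s : seq S) : store :=
  fun b => if b == a then s else st b.

Inductive op := Nop | OUp (a : reg) | OPop (a : reg) | OSet (a : reg) (x : S).

Lemma op_eq_dec (o o' : op) : decidable (o = o').
Proof. by rewrite /decidable; decide equality; apply: eq_comparable. Defined.

HB.instance Definition _ := hasDecEq.Build op (compareP op_eq_dec).

Definition exec_op (o : op) (st : store) : store :=
  match o with
  | Nop => st
  | OUp a => setr st a (blank :: st a)
  | OPop a => setr st a (behead (st a))
  | OSet a x => setr st a (x :: behead (st a))
  end.

(* A control state is the list of the commands that remain to be executed. *)
Definition nxt (scan : reg -> S) (k : seq cmd) : seq (seq cmd * op) :=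
  if k is c :: k' then
    match c with
    | Up a => [:: (k', OUp a)]
    | Pop a => [:: (k', OPop a)]
    | SetC a x => [:: (k', OSet a x)]
    | SetT a b => [:: (k', OSet a (scan b))]
    | Seq c1 c2 => [:: (c1 :: c2 :: k', Nop)]
    | While a x p c1 =>
        [:: (if (scan a == x) == p then c1 :: k else k', Nop)]
    | Ifc a x c1 c2 => [:: ((if scan a == x then c1 else c2) :: k', Nop)]
    | Or c1 c2 | And c1 c2 => [:: (c1 :: k', Nop); (c2 :: k', Nop)]
    | Halt _ => [::]
    end
  else [::].

Definition kindof (k : seq cmd) : mode :=
  match k with
  | Halt b :: _ => if b then Accepting else Rejecting
  | [::] => Rejecting
  | And _ _ :: _ => Universal
  | _ => Existential
  end.

Lemma nxt_halting scan k :
  match kindof k with Accepting | Rejecting => true | _ => false end ->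
  nxt scan k = [::].
Proof. by case: k => [|[]]. Qed.

(** Both alternatives of [Or] and [And] must be decided, so the bound covers every path of the
    computation tree and the value is that of the tree. *)
Inductive dec : nat -> seq cmd -> store -> bool -> Prop :=
| dec_halt T b k st : dec T (Halt b :: k) st b
| dec_det T k st k' o b :
    nxt (top_sym st) k = [:: (k', o)] -> dec T k' (exec_op o st) b ->
    dec T.+1 k st b
| dec_or T c1 c2 k st b1 b2 :
    dec T (c1 :: k) st b1 -> dec T (c2 :: k) st b2 ->
    dec T.+1 (Or c1 c2 :: k) st (b1 || b2)
| dec_and T c1 c2 k st b1 b2 :
    dec T (c1 :: k) st b1 -> dec T (c2 :: k) st b2 ->
    dec T.+1 (And c1 c2 :: k) st (b1 && b2).

Lemma dec_le T T' k st b : T <= T' -> dec T k st b -> dec T' k st b.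
Proof.
move=> + h; elim: h T' => {T k st b}.
- by move=> *; constructor.
- by move=> T k st k' o b e _ IH [//|T'] le_T; apply: dec_det e (IH _ _).
- by move=> T c1 c2 k st b1 b2 _ IH1 _ IH2 [//|T'] le_T; constructor; auto.
- by move=> T c1 c2 k st b1 b2 _ IH1 _ IH2 [//|T'] le_T; constructor; auto.
Qed.

(** The command lists that can arise before control returns to [k]. They are finitely many, as a
    loop body returns to the same list, and provide the states of the Turing machine. *)
Fixpoint reach (c : cmd) (k : seq cmd) : seq (seq cmd) :=
  (c :: k) ::
  match c with
  | Seq c1 c2 => reach c1 (c2 :: k) ++ reach c2 k
  | While _ _ _ c1 => reach c1 (c :: k)
  | Ifc _ _ c1 c2 | Or c1 c2 | And c1 c2 => reach c1 k ++ reach c2 k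
  | _ => [::]
  end.

Lemma reach_head c k : c :: k \in reach c k.
Proof. by case: c => *; rewrite inE eqxx. Qed.

Lemma reach_nxt scan c k l p :
  l \in reach c k -> p \in nxt scan l -> p.1 \in k :: reach c k.
Proof.
elim: c k l => /= [a|a|a x|a b|c1 IH1 c2 IH2|a x b c1 IH1|a x c1 IH1 c2 IH2|
    c1 IH1 c2 IH2|c1 IH1 c2 IH2|b] k l;
  rewrite !inE.
1-4: by move=> /eqP-> /=; rewrite inE => /eqP-> /=; rewrite eqxx.
- rewrite mem_cat => /or3P[/eqP->|/IH1 H /H|/IH2 H /H]; rewrite ?inE ?mem_cat.
  + by move=> /eqP->; rewrite reach_head ?orbT.
  + by case/orP=> [/eqP->|->]; rewrite ?reach_head ?orbT.
  + by case/orP=> [/eqP->|->]; rewrite ?eqxx ?orbT.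
- case/orP=> [/eqP-> /=|/IH1 H /H]; rewrite !inE.
    by move=> /eqP-> /=; case: ifP => _; rewrite ?eqxx ?reach_head ?orbT.
  by case/orP=> [/eqP->|->]; rewrite ?eqxx ?orbT.
- rewrite mem_cat => /or3P[/eqP->|/IH1 H /H|/IH2 H /H]; rewrite ?inE ?mem_cat.
  + by move=> /eqP-> /=; case: ifP => _; rewrite reach_head ?orbT.
  + by case/orP=> [/eqP->|->]; rewrite ?eqxx ?orbT.
  + by case/orP=> [/eqP->|->]; rewrite ?eqxx ?orbT.
1,2: rewrite mem_cat => /or3P[/eqP->|/IH1 H /H|/IH2 H /H]; rewrite ?inE ?mem_cat.
1,4: by case/orP=> /eqP-> /=; rewrite reach_head ?orbT.
1-4: by case/orP=> [/eqP->|->]; rewrite ?eqxx ?orbT.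
by move=> /eqP->.
Qed.

(** * Compilation of stack programs into alternating Turing machines *)

Variables (letter : bool -> S) (letter_inj : injective letter).
Hypothesis letter_blank : forall i, letter i != blank.
Variable main : cmd.

Let states := [::] :: reach main [::].
Let Q := 'I_(size (reach main [::])).+1.

Definition cmds_of (q : Q) : seq cmd := nth [::] states q.
Definition state_of (k : seq cmd) : Q := inord (index k states).

Lemma state_ofK k : k \in states -> cmds_of (state_of k) = k.
Proof.
move=> ks; have := ks; rewrite -index_mem => lt_ks.
by rewrite /cmds_of /state_of inordK // nth_index.
Qed.

Lemma states_nxt scan l p : l \in states -> p \in nxt scan l -> p.1 \in states.
Proof. by rewrite inE => /predU1P[->|/reach_nxt H /H]. Qed.

(* The input tape is a stack growing to the left, the other ones grow to the
   right; the head is on the top of the stack, or on a blank if it is empty. *)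
Definition opact (o : op) (r : reg) (h : S) : S * move :=
  match o with
  | Nop => (h, Stay)
  | OUp a => (h, if r != a then Stay else if a == RIn then MoveLeft else MoveRight)
  | OPop a => if r != a then (h, Stay) else
                (blank, if a == RIn then MoveRight else MoveLeft)
  | OSet a x => (if r == a then x else h, Stay)
  end.

Definition stack_atm : atm := {|
  extra_tapes := 8;
  Defs.state := Q;
  symbol := S;
  Defs.blank := blank;
  Defs.letter := letter;
  Defs.letter_inj := letter_inj;
  Defs.letter_blank := letter_blank;
  start := state_of [:: main];
  kind := fun q => kindof (cmds_of q);
  delta := fun q scan =>
    [seq (state_of p.1, [ffun i => opact p.2 (reg_of i) (scan i)])
       | p <- nxt (fun r => scan (ord_of r)) (cmds_of q)] |}.

Notation tape := (tape stack_atm).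
Notation config := (config stack_atm).

(** The numbers [n] and [m] account for visited cells that are blank again and that the tape still
    lists. *)
Definition stack_tape (r : reg) (s : seq S) (p : tape) : Prop :=
  let: (l, h, f) := p in
  let: (u, v) := if r == RIn then (f, l) else (l, f) in
  exists n m, h :: u = s ++ nseq n blank /\ v = nseq m blank.

Lemma stack_tape_top r s p : stack_tape r s p -> p.1.2 = head blank s.
Proof.
case: p => [[l h] f] /=; case: ifP => _ [n [m [+ _]]];
  by case: s => [|x s] /=; [case: n => //= n|] => -[].
Qed.

Lemma stack_tape_act o r (st : store) p :
  stack_tape r (st r) p ->
  stack_tape r (exec_op o st r) (act p (opact o r (p.1.2))).
Proof.
case: p => [[l h] f]; case: o => [|a|a|a x] //=; rewrite /setr.
- case: (eqVneq r a) => [<-|_] //=; case: ifP => rI [n [m [e ->]]].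
    by case: m => [|m]; rewrite /stack_tape /= rI;
      [exists n, 0|exists n, m]; rewrite e.
  by case: m => [|m]; rewrite /stack_tape /= rI;
    [exists n, 0|exists n, m]; rewrite e.
- case: (eqVneq r a) => [<-|_] //=; case: ifP => rI [n [m [e ->]]].
    case: f e => [|y f] e; rewrite /stack_tape rI.
      by exists 1, m.+1; case: (st r) e => [|z [|z' s]].
    case: (st r) e => [|z s] /= e; last by case: e => _ ->; exists n, m.+1.
    by case: n e => [|n] //= [_ ->]; exists n, m.+1.
  case: l e => [|y l] e; rewrite /stack_tape rI.
    by exists 1, m.+1; case: (st r) e => [|z [|z' s]].
  case: (st r) e => [|z s] /= e; last by case: e => _ ->; exists n, m.+1.
  by case: n e => [|n] //= [_ ->]; exists n, m.+1.
- case: (eqVneq r a) => [<-|_] //=; case: ifP => _ [n [m [e ->]]].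
    case: (st r) e => [|z s] /= e; last by case: e => _ ->; exists n, m.
    by case: n e => [|n] //= [_ ->]; exists n, m.
  case: (st r) e => [|z s] /= e; last by case: e => _ ->; exists n, m.
  by case: n e => [|n] //= [_ ->]; exists n, m.
Qed.

Definition represents (c : config) (k : seq cmd) (st : store) : Prop :=
  [/\ k \in states, cmds_of c.1 = k
    & forall i, stack_tape (reg_of i) (st (reg_of i)) (c.2 i)].

Definition next_config (c : config) (p : seq cmd * op) : config :=
  (state_of p.1,
   [ffun i => act (c.2 i) (opact p.2 (reg_of i) (c.2 i).1.2)]).

Lemma represents_next c k st p :
  represents c k st -> p \in nxt (top_sym st) k ->
  represents (next_config c p) p.1 (exec_op p.2 st).
Proof.
move=> [ks ck hc] pn; have ps := states_nxt ks pn.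
split=> //=; first by rewrite state_ofK.
by move=> i; rewrite ffunE; apply: stack_tape_act; apply: hc.
Qed.

Lemma successors_represents c k st :
  represents c k st ->
  successors c = [seq next_config c p | p <- nxt (top_sym st) k].
Proof.
case: c => q tp [ks /= ck hc].
have -> : nxt (top_sym st) k = nxt (fun r => (tp (ord_of r)).1.2) k.
  congr nxt; apply: functional_extensionality => r.
  by have := stack_tape_top (hc (ord_of r)); rewrite ord_ofK => /= ->.
rewrite /halting /= ck; case: ifP => [/nxt_halting -> //|_].
rewrite -map_comp.
rewrite [X in nxt X k](_ : _ = fun r => (tp (ord_of r)).1.2); last first.
  by apply: functional_extensionality => r; rewrite ffunE.
apply: eq_map => p; rewrite /next_config /=; congr pair.
by apply/ffunP => i; rewrite !ffunE.
Qed.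

Notation step := (@mstep stack_atm).

Lemma step_represents c k st c' :
  represents c k st ->
  step c c' = (c' \in [seq next_config c p | p <- nxt (top_sym st) k]).
Proof. by move=> /successors_represents <-. Qed.

Lemma path_step T c :
  (forall c', step c c' -> forall s, path step c' s -> size s <= T) ->
  forall s, path step c s -> size s <= T.+1.
Proof. by move=> h [|c' s] // /andP[cc' /(h _ cc')]. Qed.

Lemma kind_represents c k st : represents c k st -> kind c.1 = kindof k.
Proof. by case=> _ <-. Qed.

Lemma accepts_existential c :
  kind c.1 = Existential ->
  accepts c <-> exists2 c', step c c' & accepts c'.
Proof.
move=> kc; split=> [a|[c' cc' a]]; last exact: acc_existential a.
by case: a kc => [? ->|? c' _ cc' a _|? ->] //; exists c'.
Qed.

Lemma accepts_universal c :
  kind c.1 = Universal ->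
  accepts c <-> forall c', step c c' -> accepts c'.
Proof.
move=> kc; split=> [a|a]; last exact: acc_universal a.
by case: a kc => [? ->|? ? ->|].
Qed.

Lemma dec_represents T k st b c :
  dec T k st b -> represents c k st ->
  (forall s, path step c s -> size s <= T) /\ (accepts c <-> b).
Proof.
move=> h; elim: h c => {T k st b}.
- move=> T b k st c rc; have sc c' := step_represents c' rc.
  have kc := kind_represents rc.
  split; first by case=> // c' s /andP[]; rewrite sc.
  split=> [a|bt]; last by constructor; rewrite kc bt.
  by case: b kc {rc sc} => // kc; case: a kc => [? ->|? ? ->|? ->].
- move=> T k st k' o b nk _ IH c rc.
  have sc c' := step_represents c' rc.
  have := represents_next (p := (k', o)) rc; rewrite nk mem_head => /(_ isT) rc'.
  have [hT hb] := IH _ rc'.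
  (* A deterministic command is an existential choice among one successor. *)
  have kc : kind c.1 = Existential.
    by rewrite (kind_represents rc); case: k nk {rc sc} => [|[]].
  split; first by apply: path_step => c'; rewrite sc nk inE => /eqP->.
  rewrite -hb accepts_existential //; split=> [[c']|a].
    by rewrite sc nk inE => /eqP->.
  by exists (next_config c (k', o)); rewrite // sc nk mem_head.
- move=> T c1 c2 k st b1 b2 _ IH1 _ IH2 c rc.
  have sc c' := step_represents c' rc.
  have rc1 := represents_next (p := (c1 :: k, Nop)) rc (mem_head _ _).
  have rc2 := represents_next (p := (c2 :: k, Nop)) rc
    (mem_last (c1 :: k, Nop) [:: (c2 :: k, Nop)]).
  have [hT1 hb1] := IH1 _ rc1; have [hT2 hb2] := IH2 _ rc2.
  split; first by apply: path_step => c'; rewrite sc !inE => /orP[]/eqP->.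
  rewrite accepts_existential ?(kind_represents rc) //; split=> [[c']|].
    by rewrite sc !inE => /orP[]/eqP-> => [/hb1 ->|/hb2 ->]; rewrite ?orbT.
  by case/orP=> [/hb1|/hb2] a; eexists; try exact: a; rewrite sc !inE eqxx ?orbT.
- move=> T c1 c2 k st b1 b2 _ IH1 _ IH2 c rc.
  have sc c' := step_represents c' rc.
  have rc1 := represents_next (p := (c1 :: k, Nop)) rc (mem_head _ _).
  have rc2 := represents_next (p := (c2 :: k, Nop)) rc
    (mem_last (c1 :: k, Nop) [:: (c2 :: k, Nop)]).
  have [hT1 hb1] := IH1 _ rc1; have [hT2 hb2] := IH2 _ rc2.
  split; first by apply: path_step => c'; rewrite sc !inE => /orP[]/eqP->.
  rewrite accepts_universal ?(kind_represents rc) //; split=> [a|].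
    by apply/andP; split; [apply/hb1|apply/hb2]; apply: a; rewrite sc !inE eqxx ?orbT.
  by move=> /andP[/hb1 a1 /hb2 a2] c'; rewrite sc !inE => /orP[]/eqP->.
Qed.

Definition input_store (w : word) : store :=
  fun r => if r is RIn then map letter w else [::].

Lemma represents_initial w :
  represents (initial stack_atm w) [:: main] (input_store w).
Proof.
have ms : [:: main] \in states by rewrite inE reach_head orbT.
split=> //=; first by rewrite state_ofK.
move=> i; rewrite ffunE; case: eqP => [->|i0].
  by case: w => [|x w] /=; [exists 1, 0|exists 0, 0; rewrite cats0].
have : reg_of i != RIn.
  by apply/eqP => ri; apply: i0; rewrite -[i]reg_ofK ri; apply: val_inj.
by case: (reg_of i) => //= _; exists 1, 0.
Qed.

Theorem stack_atm_decides (L : language) (T : word -> nat) :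
  (forall w, exists2 b, dec (T w) [:: main] (input_store w) b & b <-> L w) ->
  decides_within stack_atm L T.
Proof.
move=> h w; have [b db bL] := h w.
have [hT hb] := dec_represents db (represents_initial w).
by split=> //; rewrite hb.
Qed.

End Language.

(** * Stack macros and their running times *)

Section Macros.
Variables (S : finType) (blank : S).
Notation cmd := (cmd S).
Notation store := (store S).
Notation dec := (dec blank).
Notation top := (top_sym blank).

(** Stated through an arbitrary continuation: whatever is decided after [c] is decided from before
    [c] with [n] more steps. This makes sequencing immediate. *)
Variant exec (n : nat) (c : cmd) (st st' : store) : Prop :=
  Exec of forall T k b, dec T k st' b -> dec (n + T) (c :: k) st b.

Lemma exec_dec n c st st' T k b :
  exec n c st st' -> dec T k st' b -> dec (n + T) (c :: k) st b.
Proof. by case; apply. Qed.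

Lemma exec_le n m c st st' : n <= m -> exec n c st st' -> exec m c st st'.
Proof. by move=> nm [h]; split=> T k b /h; apply: dec_le; lia. Qed.

Lemma exec_eq n c st st1 st2 : exec n c st st1 -> st1 = st2 -> exec n c st st2.
Proof. by move=> h <-. Qed.

Lemma exec_up a (st : store) : exec 1 (Up S a) st (setr st a (blank :: st a)).
Proof. by split=> T k b; apply: (dec_det (o := OUp S a)). Qed.

Lemma exec_pop a (st : store) : exec 1 (Pop S a) st (setr st a (behead (st a))).
Proof. by split=> T k b; apply: (dec_det (o := OPop S a)). Qed.

Lemma exec_setC a x st : exec 1 (SetC a x) st (setr st a (x :: behead (st a))).
Proof. by split=> T k b; apply: (dec_det (o := OSet a x)). Qed.

Lemma exec_setT a a' st :
  exec 1 (SetT S a a') st (setr st a (top st a' :: behead (st a))).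
Proof. by split=> T k b; apply: (dec_det (o := OSet a (top st a'))). Qed.

Lemma exec_seq n m c c' st st1 st2 :
  exec n c st st1 -> exec m c' st1 st2 -> exec (n + m).+1 (Seq c c') st st2.
Proof.
move=> [h] [h']; split=> T k b /h'/h; rewrite addnA => d.
exact: (@dec_det _ _ _ _ _ (c :: c' :: k) (Nop S)).
Qed.

Lemma exec_while_true n m a x p c st st1 st2 :
  (top st a == x) == p -> exec n c st st1 -> exec m (While a x p c) st1 st2 ->
  exec (n + m).+1 (While a x p c) st st2.
Proof.
move=> e [h] [h']; split=> T k b /h'/h; rewrite addnA => d.
by apply: (@dec_det _ _ _ _ _ (c :: While a x p c :: k) (Nop S)); rewrite //= e.
Qed.

Lemma exec_while_false a x p c (st : store) :
  (top st a == x) == ~~ p -> exec 1 (While a x p c) st st.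
Proof.
move=> e; split=> T k b; apply: (@dec_det _ _ _ _ _ k (Nop S)).
by rewrite /= (eqP e); case: p {e}.
Qed.

Lemma exec_if n a x c c' st st' :
  exec n (if top st a == x then c else c') st st' ->
  exec n.+1 (Ifc a x c c') st st'.
Proof. by move=> [h]; split=> T k b /h; apply: (dec_det (o := Nop S)). Qed.

Lemma setr_eq (st : store) a s : st a = s -> setr st a s = st.
Proof.
by move=> <-; apply: functional_extensionality => r; rewrite /setr; case: eqP => [->|].
Qed.

Definition push (a : reg) (x : S) : cmd := Seq (Up S a) (SetC a x).

Lemma exec_push a x (st : store) : exec 3 (push a x) st (setr st a (x :: st a)).
Proof.
have := exec_seq (exec_up a st) (exec_setC a x _).
congr exec; apply: functional_extensionality => r; rewrite /setr eqxx.
by case: eqP.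
Qed.

Definition mv (a b : reg) : cmd := Seq (Up S b) (Seq (SetT S b a) (Pop S a)).

Lemma exec_mv a b (st : store) : a != b ->
  exec 5 (mv a b) st (setr (setr st a (behead (st a))) b (top st a :: st b)).
Proof.
move=> ab; have := exec_seq (exec_up b st) (exec_seq (exec_setT b a _) (exec_pop a _)).
congr exec; apply: functional_extensionality => r.
rewrite /top_sym /setr !eqxx (negbTE ab).
by case: (eqVneq r a) => [->|_]; rewrite ?(negbTE ab) //; case: eqP.
Qed.

(** The flag [p] selects moving while the top is [x] or until it is [x]. The moved symbols arrive in
    reverse order. *)
Definition mvw (a : reg) (x : S) (p : bool) (b : reg) : cmd :=
  While a x p (mv a b).

Lemma exec_mvw a x p b st u r : a != b ->
  st a = u ++ r -> all (fun y => (y == x) == p) u ->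
  (head blank r == x) == ~~ p ->
  exec (6 * size u).+1 (mvw a x p b) st
    (setr (setr st a r) b (catrev u (st b))).
Proof.
move=> ab; elim: u st => [|y u IH] st sta.
  move=> _ hr; rewrite (setr_eq sta) setr_eq //.
  by apply: exec_while_false; rewrite /top_sym sta.
move=> /= /andP[yx ux] hr.
pose st1 := setr (setr st a (behead (st a))) b (top st a :: st b).
have st1a : st1 a = u ++ r by rewrite /st1 /setr (negbTE ab) eqxx sta.
have top_a : top st a = y by rewrite /top_sym sta.
apply: (@exec_le (5 + (6 * size u).+1).+1); first by rewrite /=; lia.
apply: exec_while_true (exec_mv _ ab) _; first by rewrite top_a.
have := IH st1 st1a ux hr.
congr exec; apply: functional_extensionality => z.
rewrite /st1 /setr eqxx top_a; case: (eqVneq z b) => // zb.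
by case: (eqVneq z a).
Qed.

(** Reading a unary number consumes it, so two copies are produced, one of which serves to restore
    the source. *)
Definition dup (a : reg) (x : S) (b c : reg) : cmd :=
  While a x true (Seq (Pop S a) (Seq (push b x) (push c x))).

Lemma exec_dup a x b c st n r : a != b -> a != c -> b != c ->
  st a = nseq n x ++ r -> head blank r != x ->
  exec (10 * n).+1 (dup a x b c) st
    (setr (setr (setr st a r) b (nseq n x ++ st b)) c (nseq n x ++ st c)).
Proof.
move=> ab ac bc; elim: n st => [|n IH] st sta hr.
  rewrite (setr_eq sta) !setr_eq //.
  by apply: exec_while_false; rewrite /top_sym sta (negbTE hr).
apply: (@exec_le (9 + (10 * n).+1).+1); first by lia.
pose st1 := setr (setr (setr st a (nseq n x ++ r)) b (x :: st b)) c (x :: st c).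
apply: (exec_while_true (st1 := st1)).
- by rewrite /top_sym sta /= eqxx.
- have := exec_seq (exec_pop a st) (exec_seq (exec_push b x _) (exec_push c x _)).
  congr exec; apply: functional_extensionality => z; rewrite /st1 /setr sta.
  rewrite (eq_sym c b) (negbTE bc) (eq_sym c a) (negbTE ac) (eq_sym b a) (negbTE ab).
  by [].
have st1a : st1 a = nseq n x ++ r by rewrite /st1 /setr (negbTE ac) (negbTE ab) eqxx.
have := IH st1 st1a hr.
congr exec; apply: functional_extensionality => z; rewrite /st1 /setr.
rewrite (negbTE bc) !eqxx.
have nx s : nseq n x ++ x :: s = nseq n.+1 x ++ s by elim: (n) => //= m ->.
case: (eqVneq z c) => // _; case: (eqVneq z b) => // _; by case: eqP.
Qed.

Definition drop_all (a : reg) : cmd := While a blank false (Pop S a).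

Lemma exec_drop_all a (st : store) :
  all (predC1 blank) (st a) ->
  exec (2 * size (st a)).+1 (drop_all a) st (setr st a [::]).
Proof.
move E: (st a) => s; elim: s st E => [|y s IH] st E /=.
  by move=> _; rewrite setr_eq //; apply: exec_while_false; rewrite /top_sym E eqxx.
move=> /andP[yb sb]; apply: (@exec_le (1 + (2 * size s).+1).+1); first by lia.
apply: exec_while_true (exec_pop _ _) _; first by rewrite /top_sym E /= (negbTE yb).
have st1a : setr st a (behead (st a)) a = s by rewrite /setr eqxx E.
have := IH _ st1a sb.
by congr exec; apply: functional_extensionality => z; rewrite /setr; case: eqP.
Qed.

(** Explicit stores, on which [setr_mk] computes updates during symbolic execution. *)
Definition mk (i h b e t k s c g : seq S) : store := fun r =>
  match r with
  | RIn => i | RH => h | RB => b | RE => e | RT => t | RK => k | RS => s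
  | RC => c | RG => g
  end.

Lemma setr_mk r x i h b e t k s c g :
  setr (mk i h b e t k s c g) r x =
  match r with
  | RIn => mk x h b e t k s c g
  | RH => mk i x b e t k s c g
  | RB => mk i h x e t k s c g
  | RE => mk i h b x t k s c g
  | RT => mk i h b e x k s c g
  | RK => mk i h b e t x s c g
  | RS => mk i h b e t k x c g
  | RC => mk i h b e t k s x g
  | RG => mk i h b e t k s c x
  end.
Proof. by case: r; apply: functional_extensionality => -[]. Qed.

End Macros.

Lemma catrev_nseq T n (x : T) s : catrev (nseq n x) s = nseq n x ++ s.
Proof.
elim: n s => //= n IH s; rewrite IH; elim: (n) => //= m -> //.
Qed.

Lemma rev_nseq T n (x : T) : rev (nseq n x) = nseq n x.
Proof. by rewrite /rev catrev_nseq cats0. Qed.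

Ltac xseq L :=
  eapply exec_seq; [eapply L; try done|]; rewrite ?setr_mk ?catrev_nseq.
Ltac xend L :=
  eapply exec_eq; [eapply L; try done|]; rewrite ?setr_mk ?catrev_nseq.
Ltac xmvw w :=
  eapply exec_seq;
  [eapply (@exec_mvw _ _ _ _ _ _ _ w); [done|reflexivity| |done]|];
  rewrite ?setr_mk ?catrev_nseq.

(** * The abstract machine as a stack program *)

Section Program.
Variable n : nat.

Notation code := 'I_n.+1.
(* Letters, four marks, and the codes of the subterms of the program. *)
Notation sym := (bool + bool * bool + code)%type.

Definition sblank : sym := inl (inr (false, false)).
Definition sone : sym := inl (inr (false, true)).
Definition ssep : sym := inl (inr (true, false)).
Definition send : sym := inl (inr (true, true)).
Definition slet (b : bool) : sym := inl (inl b).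
Definition scode (k : code) : sym := inr k.

(** A cell [(k, a, e)] extends the parent environment [e] by the closure of code [k] in environment
    [a]. Pointers number the cells from the oldest, so they stay valid when a cell is added in
    front; 0 is the empty environment. *)
Definition cell : Type := code * nat * nat.

Definition cellw (x : cell) : seq sym :=
  scode x.1.1 :: nseq x.1.2 sone ++ ssep :: nseq x.2 sone ++ [:: send].

Definition heapw (hs : seq cell) : seq sym := flatten (map cellw hs).

Definition closw (x : code * nat) : seq sym :=
  scode x.1 :: nseq x.2 sone ++ [:: ssep].

Definition stackw (s : seq (code * nat)) : seq sym := flatten (map closw s).

Notation cmd := (cmd sym).
Notation exec := (@exec sym sblank).
Notation dec := (@dec sym sblank).

Definition mk1 h b e t k s c g : store sym := @mk sym [::] h b e t k s c g.

Lemma rev_cellw x :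
  rev (cellw x) =
  send :: nseq x.2 sone ++ ssep :: nseq x.1.2 sone ++ [:: scode x.1.1].
Proof.
rewrite /cellw -cat1s rev_cat rev_cat rev_cons rev_cat !rev_nseq /=.
by rewrite cat_rcons -!catA.
Qed.

Lemma heapw_cat hs hs' : heapw (hs ++ hs') = heapw hs ++ heapw hs'.
Proof. by rewrite /heapw map_cat flatten_cat. Qed.

Lemma rev_heapw_rcons hs x :
  rev (heapw (rcons hs x)) = rev (cellw x) ++ rev (heapw hs).
Proof. by rewrite -cats1 heapw_cat rev_cat /heapw /= cats0. Qed.

Lemma heapw_nblank hs : all (fun y => (y == sblank) == false) (heapw hs).
Proof.
elim: hs => //= x hs IH; rewrite /heapw /= all_cat; apply/andP; split=> //.
by rewrite !(all_cat, all_nseq) /= all_cat all_nseq /= !orbT.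
Qed.

Lemma stackw_nblank s : all (predC1 sblank) (stackw s).
Proof.
elim: s => //= x s IH; rewrite /stackw /= all_cat; apply/andP; split=> //.
by rewrite !(all_cat, all_nseq) /= !orbT.
Qed.

Definition movecell : cmd :=
  Seq (mv _ RB RH) (Seq (mvw RB ssep false RH) (Seq (mv _ RB RH)
    (Seq (mvw RB sone true RH) (mv _ RB RH)))).

Lemma all_ones (x : sym) p m : (sone == x) == p ->
  all (fun y : sym => (y == x) == p) (nseq m sone).
Proof. by move=> e; rewrite all_nseq e orbT. Qed.

Lemma exec_movecell new old x i e t k s c g :
  exec (6 * x.1.2 + 6 * x.2 + 21) movecell
    (mk i (heapw old) (rev (heapw (rcons new x))) e t k s c g)
    (mk i (heapw (x :: old)) (rev (heapw new)) e t k s c g).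
Proof.
rewrite rev_heapw_rcons rev_cellw /= -!catA /= -catA /=.
apply: exec_le; last first.
  xseq exec_mv.
  xmvw (nseq x.2 sone); first exact: all_ones.
  xseq exec_mv.
  xmvw (nseq x.1.2 sone); first exact: all_ones.
  xend exec_mv.
  by rewrite /heapw /= /cellw /= -!catA /= -!catA.
by rewrite !size_nseq; lia.
Qed.

Definition cellok (M : nat) (x : cell) : bool := (x.1.2 <= M) && (x.2 <= M).

(** With the heap reversed into [RB] the oldest cell is on top; moving back as many cells as the
    pointer in [RE] counts puts the cell it denotes on top of [RH]. *)
Definition loop : cmd := While RE sone true (Seq (Pop _ RE) movecell).

Lemma exec_loop M new old i e t k s c g :
  e <= size new -> all (cellok M) new ->
  exec (e * (12 * M + 24)).+1 loop
    (mk i (heapw old) (rev (heapw new)) (nseq e sone) t k s c g)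
    (mk i (heapw (drop (size new - e) new ++ old))
          (rev (heapw (take (size new - e) new))) [::] t k s c g).
Proof.
elim: e new old => [|e IH] new old.
  by rewrite subn0 drop_size take_size => _ _; apply: exec_while_false.
case: (lastP new) => // {}new x; rewrite size_rcons ltnS subSS => le_e.
rewrite all_rcons => /andP[/andP[xa xb] newM].
rewrite drop_rcons ?leq_subr // -cats1 takel_cat ?leq_subr // cat_rcons cats1.
apply: exec_le; last first.
  apply: exec_while_true; first by [].
    xseq exec_pop; exact: exec_movecell.
  exact: IH.
by move: xa xb; rewrite mulSn; lia.
Qed.

Lemma size_cellw x : size (cellw x) = x.1.2 + x.2 + 3.
Proof. by rewrite /cellw /= !(size_cat, size_nseq) /= !(size_cat, size_nseq) /=; lia. Qed.

Lemma size_heapw M hs : all (cellok M) hs -> size (heapw hs) <= size hs * (2 * M + 3).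
Proof.
elim: hs => [//|x hs IH] /andP[/andP[xa xb] /IH {}IH].
rewrite -[heapw _]/(cellw x ++ heapw hs) size_cat size_cellw.
by rewrite -[size (x :: hs)]/(size hs).+1 (mulSn (size hs)); lia.
Qed.

Definition get_clo : cmd :=
  Seq (mvw RH sblank false RB) (Seq loop (Seq (SetT _ RC RH) (Seq (mv _ RH RB)
    (Seq (dup RH sone RB RE) (mvw RB sblank false RH))))).

Definition get_par : cmd :=
  Seq (mvw RH sblank false RB) (Seq loop (Seq (mv _ RH RB)
    (Seq (mvw RH sone true RB) (Seq (mv _ RH RB)
      (Seq (dup RH sone RB RE) (mvw RB sblank false RH)))))).

Definition cost (M : nat) : nat := 150 * M.+1 ^ 2.

Lemma costE M : cost M = 150 * (M * M) + 300 * M + 150.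
Proof. by rewrite /cost -mulnn; nia. Qed.

Lemma heapw_access hs e x older :
  drop (size hs - e) hs = x :: older -> 
  heapw hs = heapw (take (size hs - e) hs) ++ cellw x ++ heapw older.
Proof.
by move=> E; rewrite -{1}(cat_take_drop (size hs - e) hs) E heapw_cat.
Qed.

Lemma size_access hs e x older M :
  all (cellok M) hs -> drop (size hs - e) hs = x :: older ->
  [/\ x.1.2 <= M, x.2 <= M & size (heapw (take (size hs - e) hs)) + size (cellw x)
      <= size (heapw hs)].
Proof.
move=> + E; rewrite -{1}(cat_take_drop (size hs - e) hs) E all_cat.
case/andP=> _ /andP[/andP[xa xb] _]; split=> //.
by rewrite (heapw_access E) !size_cat; lia.
Qed.

Lemma exec_get_clo M hs e x older k s y g :
  size hs <= M -> all (cellok M) hs -> e <= size hs ->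
  drop (size hs - e) hs = x :: older ->
  exec (cost M) get_clo
    (mk1 (heapw hs) [::] (nseq e sone) [::] k s [:: y] g)
    (mk1 (heapw hs) [::] (nseq x.1.2 sone) [::] k s [:: scode x.1.1] g).
Proof.
move=> hsM hsok le_e E; have [xa xb szE] := size_access hsok E.
have := size_heapw hsok => szH.
apply: exec_le; last first.
  rewrite /get_clo /mk1.
  eapply exec_seq.
    by apply: (exec_mvw (u := heapw hs) (r := [::]));
      rewrite ?cats0 ?heapw_nblank.
  rewrite !setr_mk -[catrev _ _]/(rev _).
  eapply exec_seq.
    by apply: (@exec_loop M hs [::]) le_e hsok.
  rewrite cats0 E -cat1s heapw_cat /= {1}/heapw /= cats0.
  xseq exec_setT; rewrite /top_sym /=.
  xseq exec_mv; rewrite /top_sym /= -catA /=.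
  eapply exec_seq.
    by eapply exec_dup; [done|done|done|reflexivity|].
  rewrite !setr_mk cats0.
  eapply exec_eq.
    apply: (exec_mvw (r := [::]) (u := nseq x.1.2 sone ++ scode x.1.1 ::
      rev (heapw (take (size hs - e) hs)))) => //.
      by rewrite /= cats0.
    by rewrite all_cat all_nseq /= orbT all_rev heapw_nblank.
  rewrite !setr_mk {1}(heapw_access E); congr mk.
  rewrite catrevE rev_cat rev_cons revK rev_nseq /cellw /= -!cats1 -!catA /=.
  by rewrite -!catA.
rewrite size_cat /= size_rev !size_nseq.
have [Hb Lb] : size (heapw hs) <= 2 * (M * M) + 3 * M /\
    e * (12 * M + 24) <= 12 * (M * M) + 24 * M by split; nia.
by move: szE; rewrite size_cellw costE; lia.
Qed.

Lemma exec_get_par M hs e x older k s y g :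
  size hs <= M -> all (cellok M) hs -> e <= size hs ->
  drop (size hs - e) hs = x :: older ->
  exec (cost M) get_par
    (mk1 (heapw hs) [::] (nseq e sone) [::] k s [:: y] g)
    (mk1 (heapw hs) [::] (nseq x.2 sone) [::] k s [:: y] g).
Proof.
move=> hsM hsok le_e E; have [xa xb szE] := size_access hsok E.
have := size_heapw hsok => szH.
apply: exec_le; last first.
  rewrite /get_par /mk1.
  eapply exec_seq.
    by apply: (exec_mvw (u := heapw hs) (r := [::]));
      rewrite ?cats0 ?heapw_nblank.
  rewrite !setr_mk -[catrev _ _]/(rev _).
  eapply exec_seq.
    by apply: (@exec_loop M hs [::]) le_e hsok.
  rewrite cats0 E -cat1s heapw_cat /= {1}/heapw /= cats0.
  xseq exec_mv; rewrite /top_sym /= -catA /= -catA /=.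
  xmvw (nseq x.1.2 sone); first exact: all_ones.
  xseq exec_mv; rewrite /top_sym /=.
  eapply exec_seq.
    by eapply exec_dup; [done|done|done|reflexivity|].
  rewrite !setr_mk cats0.
  eapply exec_eq.
    apply: (exec_mvw (r := [::]) (u := nseq x.2 sone ++ ssep :: nseq x.1.2 sone ++
      scode x.1.1 :: rev (heapw (take (size hs - e) hs)))) => //.
      by rewrite /= cats0.
    by rewrite all_cat all_nseq /= orbT /= all_cat all_nseq orbT /= all_rev heapw_nblank.
  rewrite !setr_mk {1}(heapw_access E); congr mk.
  rewrite catrevE rev_cat rev_cons rev_cat rev_cons revK !rev_nseq /cellw /=.
  by rewrite -!cats1 -!catA /= -?catA /= -?catA.
rewrite size_cat /= size_cat /= size_rev !size_nseq.
have [Hb Lb] : size (heapw hs) <= 2 * (M * M) + 3 * M /\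
    e * (12 * M + 24) <= 12 * (M * M) + 24 * M by split; nia.
by move: szE; rewrite size_cellw costE; lia.
Qed.

Definition push_clo (kt ku : code) : cmd :=
  Seq (push RS ssep) (Seq (dup RE sone RS RT) (Seq (mvw RT sone true RE)
    (Seq (push RS (scode ku)) (SetC RC (scode kt))))).

(** A new cell is written from its last symbol to its first, since [RH] is a stack. Its number is
    the new heap size, kept in [RK] and copied to [RE]. *)
Definition pop_clo (kt : code) : cmd :=
  Seq (push RH send) (Seq (mvw RE sone true RH) (Seq (push RH ssep)
  (Seq (mv _ RS RT) (Seq (mvw RS sone true RH) (Seq (Pop _ RS) (Seq (mv _ RT RH)
  (Seq (push RK sone) (Seq (dup RK sone RE RT) (Seq (mvw RT sone true RK)
  (SetC RC (scode kt))))))))))).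

Lemma exec_push_clo M h e k s kt ku y g :
  e <= M ->
  exec (cost M) (push_clo kt ku)
    (mk1 h [::] (nseq e sone) [::] k (stackw s) [:: y] g)
    (mk1 h [::] (nseq e sone) [::] k (stackw ((ku, e) :: s)) [:: scode kt] g).
Proof.
move=> eM; apply: exec_le; last first.
  rewrite /push_clo /mk1.
  xseq exec_push.
  eapply exec_seq.
    by eapply exec_dup; [done|done|done|exact: (esym (cats0 _))|].
  rewrite !setr_mk !cats0.
  eapply exec_seq.
    eapply (exec_mvw (u := nseq e sone) (r := [::])); rewrite ?cats0 //.
    by rewrite all_nseq orbT.
  rewrite !setr_mk catrev_nseq cats0.
  xseq exec_push.
  xend exec_setC.
  by rewrite /stackw /= /closw /= -catA.
by rewrite size_nseq costE; nia.
Qed.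

Lemma exec_pop_clo M hs e s kt ku a y g :
  e <= M -> a <= M -> size hs <= M ->
  exec (cost M) (pop_clo kt)
    (mk1 (heapw hs) [::] (nseq e sone) [::] (nseq (size hs) sone)
       (stackw ((ku, a) :: s)) [:: y] g)
    (mk1 (heapw ((ku, a, e) :: hs)) [::] (nseq (size hs).+1 sone) [::]
       (nseq (size hs).+1 sone) (stackw s) [:: scode kt] g).
Proof.
move=> eM aM hM; apply: exec_le; last first.
  rewrite /pop_clo /mk1.
  xseq exec_push.
  eapply exec_seq.
    eapply (exec_mvw (u := nseq e sone) (r := [::])); rewrite ?cats0 //.
    by rewrite all_nseq orbT.
  rewrite !setr_mk catrev_nseq.
  xseq exec_push.
  xseq exec_mv; rewrite /top_sym /= -catA /=.
  xmvw (nseq a sone); first by rewrite all_nseq orbT.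
  xseq exec_pop.
  xseq exec_mv; rewrite /top_sym /=.
  xseq exec_push.
  eapply exec_seq.
    by eapply (exec_dup (n := (size hs).+1)); [done|done|done|exact: (esym (cats0 _))|].
  rewrite !setr_mk !cats0.
  eapply exec_seq.
    eapply (exec_mvw (u := nseq (size hs).+1 sone) (r := [::])); rewrite ?cats0 //.
    by rewrite all_nseq orbT.
  rewrite !setr_mk catrev_nseq cats0.
  xend exec_setC.
  by rewrite /heapw /= /cellw /= -!catA /= -catA.
by rewrite !size_nseq costE; nia.
Qed.

(** * The evaluation loop, its correctness and its cost *)

Variables (cd : code -> tm) (codeof : tm -> code).

Definition guard (k : code) (b : bool) : cmd :=
  Seq (drop_all sblank RS) (Seq (SetC RG (slet b)) (SetC RC (scode k))).

(** For a conditional, the value of the test is chosen existentially; a universal choice then either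
    checks it or continues with the branch. A positive index moves to the parent environment and is
    decremented. *)
Definition step_cmd (k : code) : cmd :=
  match cd k with
  | Var 0 => get_clo
  | Var m.+1 => Seq (get_par) (SetC RC (scode (codeof (Var m))))
  | App t u => push_clo (codeof t) (codeof u)
  | Lam t => pop_clo (codeof t)
  | If t u v =>
      Or (And (guard (codeof t) true) (SetC RC (scode (codeof u))))
         (And (guard (codeof t) false) (SetC RC (scode (codeof v))))
  | tmT => Ifc RG (slet true) (Halt _ true) (Halt _ false)
  | tmF => Ifc RG (slet false) (Halt _ true) (Halt _ false)
  end.

Definition dispatch (s : seq code) : cmd :=
  foldr (fun k c => Ifc RC (scode k) (step_cmd k) c) (Halt _ false) s.

Definition run : cmd := While RC sblank false (dispatch (enum 'I_n.+1)).

Lemma dec_dispatch s k T K st b :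
  k \in s -> top_sym sblank st RC = scode k ->
  dec T (step_cmd k :: K) st b -> dec (size s + T) (dispatch s :: K) st b.
Proof.
move=> + tk d; elim: s => //= a s IH; rewrite inE addSn => ks.
apply: (@dec_det _ _ _ _ _ ((if k == a then step_cmd k else dispatch s) :: K) (Nop _)).
  rewrite /= tk (_ : (scode k == scode a) = (k == a)).
    by case: eqP => [->|].
  by apply/eqP/eqP => [[]|->].
case: eqVneq ks => [_ _|_ /= /IH] //.
by apply: dec_le d; rewrite leq_addl.
Qed.

Lemma dec_run k T st b :
  top_sym sblank st RC = scode k ->
  dec T [:: step_cmd k; run] st b -> dec (n + 2 + T) [:: run] st b.
Proof.
move=> tk d; have -> : n + 2 + T = (size (enum 'I_n.+1) + T).+1.
  by rewrite size_enum_ord; lia.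
apply: (@dec_det _ _ _ _ _ [:: dispatch (enum 'I_n.+1); run] (Nop _)).
  by rewrite /= tk.
by apply: dec_dispatch d => //; rewrite mem_enum.
Qed.

Lemma dec_run_exec k N T st st' b :
  top_sym sblank st RC = scode k -> exec N (step_cmd k) st st' ->
  dec T [:: run] st' b -> dec (n + 2 + N + T) [:: run] st b.
Proof.
move=> tk h d; rewrite -addnA; apply: dec_run tk _; exact: exec_dec h d.
Qed.

(** Both pointers of a cell are smaller than its own number, so lookups decrease the pointer. A
    variable out of range decodes to the default [Var 0], which no rule of [halts] covers. *)
Inductive env (hs : seq cell) : nat -> seq tm -> Prop :=
| env_nil : env hs 0 [::]
| env_cons e x older ra rb :
    drop (size hs - e.+1) hs = x :: older -> size older = e ->
    x.1.2 <= e -> x.2 <= e -> env hs x.1.2 ra -> env hs x.2 rb ->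
    env hs e.+1 (subst (nth (Var 0) ra) (cd x.1.1) :: rb).

Lemma env_size hs e r : env hs e r -> e <= size hs.
Proof.
case=> // {}e x older ra rb E so _ _ _ _; have := congr1 size E.
by rewrite size_drop /= so; lia.
Qed.

Lemma env_cases hs e r : env hs e r ->
  r = [::] \/ exists x older ra rb,
    [/\ r = subst (nth (Var 0) ra) (cd x.1.1) :: rb,
        drop (size hs - e) hs = x :: older, x.1.2 < e, x.2 < e
      & env hs x.1.2 ra /\ env hs x.2 rb].
Proof.
case=> [|{}e x older ra rb E _ l1 l2 ea eb]; first by left.
by right; exists x, older, ra, rb.
Qed.

Lemma env_extend x hs e r : env hs e r -> env (x :: hs) e r.
Proof.
elim=> [|{}e y older ra rb E so le1 le2 h1 IH1 h2 IH2]; first by constructor.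
have es : e.+1 <= size hs.
  by have := congr1 size E; rewrite size_drop /= so; lia.
apply: env_cons so le1 le2 IH1 IH2.
by rewrite (_ : _ - _ = (size hs - e.+1).+1) //=; lia.
Qed.

Definition clo (hs : seq cell) (x : code * nat) (M : tm) : Prop :=
  exists2 r, env hs x.2 r & M = subst (nth (Var 0) r) (cd x.1).

Inductive clos (hs : seq cell) : seq (code * nat) -> seq tm -> Prop :=
| clos_nil : clos hs [::] [::]
| clos_cons x M s p : clo hs x M -> clos hs s p -> clos hs (x :: s) (M :: p).

Lemma clos_extend x hs s p : clos hs s p -> clos (x :: hs) s p.
Proof.
elim=> [|y M {}s {}p [r er ->] _ IH]; constructor=> //.
by exists r => //; apply: env_extend.
Qed.

(** A variable is weighted by the number of environment accesses in its lookup. *)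
Fixpoint csize (t : tm) : nat :=
  match t with
  | Var m => m.+1
  | tmF | tmT => 1
  | Lam t => (csize t).+1
  | App t u => (csize t + csize u).+1
  | If t u v => (csize t + csize u + csize v).+1
  end.

Lemma csize_gt0 t : 0 < csize t. Proof. by case: t. Qed.

Hypothesis cd_var : forall k m, cd k = Var m.+1 -> cd (codeof (Var m)) = Var m.
Hypothesis cd_lam : forall k t, cd k = Lam t -> cd (codeof t) = t.
Hypothesis cd_app : forall k t u, cd k = App t u ->
  cd (codeof t) = t /\ cd (codeof u) = u.
Hypothesis cd_if : forall k t u v, cd k = If t u v ->
  [/\ cd (codeof t) = t, cd (codeof u) = u & cd (codeof v) = v].
Variable A : nat.
Hypothesis csize_cd : forall k, csize (cd k) <= A.

Variables (Hm Z : nat).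

Definition step_cost : nat := n + cost Hm + 2 * Z + 20.

Definition kstate hs e s c g : store sym :=
  mk1 (heapw hs) [::] (nseq e sone) [::] (nseq (size hs) sone) (stackw s)
      [:: scode c] [:: slet g].

Theorem dec_krivine Phi k c e s hs M p g b :
  halts k M p -> ev M p b -> clo hs (c, e) M -> clos hs s p ->
  k * (Hm.+1 * A.+1) + e * A.+1 + csize (cd c) <= Phi ->
  size hs + k <= Hm -> all (cellok Hm) hs ->
  size (stackw s) + (Hm + 2) * Phi <= Z ->
  dec (Phi * step_cost) [:: run] (kstate hs e s c g) (b == g).
Proof.
elim: Phi k c e s hs M p g b => [|Phi IH] k c e s hs M p g b.
  by have := csize_gt0 (cd c); lia.
move=> hM eM [/= r er EM] hp hPhi hk hok hZ.
have le_e := env_size er.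
have topc : top_sym sblank (kstate hs e s c g) RC = scode c by [].
have step N st' : N <= cost Hm + 2 * Z + 17 ->
    exec N (step_cmd c) (kstate hs e s c g) st' ->
    dec (Phi * step_cost) [:: run] st' (b == g) ->
    dec (Phi.+1 * step_cost) [:: run] (kstate hs e s c g) (b == g).
  move=> leN h d; apply: dec_le (dec_run_exec topc h d).
  by rewrite mulSn /step_cost; lia.
have le_eH : e <= Hm by lia.
have le_hH : size hs <= Hm by lia.
have cA := csize_cd c.
case E: (cd c) EM cA hPhi => [[|m]|||t|t u|t u v] /= EM cA hPhi.
- case: (env_cases er) => [r0|[x [older [ra [rb [rE Ed l1 l2 [ea eb]]]]]]].
    by rewrite EM r0 in hM; inversion hM.
  have := exec_get_clo (nseq (size hs) sone) (stackw s) (scode c) [:: slet g]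
    le_hH hok le_e Ed.
  move=> h; apply: (step (cost Hm)); first by lia.
    by rewrite /step_cmd E; exact: h.
  apply: (IH k x.1.1 x.1.2) hM eM _ hp _ hk hok _.
  + by exists ra; rewrite // EM rE.
  + have := csize_cd x.1.1.
    have : x.1.2.+1 * A.+1 <= e * A.+1 by rewrite leq_mul2r l1 orbT.
    by rewrite mulSn; lia.
  + by nia.
- case: (env_cases er) => [r0|[x [older [ra [rb [rE Ed l1 l2 [ea eb]]]]]]].
    by rewrite EM r0 in hM; inversion hM.
  have h := exec_get_par (nseq (size hs) sone) (stackw s) (scode c) [:: slet g]
    le_hH hok le_e Ed.
  apply: (step (cost Hm + 1).+1); first by lia.
    rewrite /step_cmd E; apply: exec_seq h _.
    by apply: exec_eq (exec_setC _ _ _ _) _; rewrite /mk1 setr_mk.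
  have Em := cd_var E.
  apply: (IH k (codeof (Var m)) x.2) hM eM _ hp _ hk hok _.
  + by exists rb; rewrite // EM rE Em.
  + have : x.2.+1 * A.+1 <= e * A.+1 by rewrite leq_mul2r l2 orbT.
    by rewrite Em mulSn /=; lia.
  + by nia.
- rewrite EM in hM eM; inversion hM; subst; inversion eM; subst.
  apply: (@dec_le _ _ (n + 2 + 1)); first by rewrite mulSn /step_cost; lia.
  apply: dec_run topc _; rewrite /step_cmd E.
  apply: (@dec_det _ _ _ _ _ [:: Halt _ (false == g); run] (Nop _)).
    by rewrite /= -[top_sym _ _ _]/(slet g); case: (g).
  exact: dec_halt.
- rewrite EM in hM eM; inversion hM; subst; inversion eM; subst.
  apply: (@dec_le _ _ (n + 2 + 1)); first by rewrite mulSn /step_cost; lia.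
  apply: dec_run topc _; rewrite /step_cmd E.
  apply: (@dec_det _ _ _ _ _ [:: Halt _ (true == g); run] (Nop _)).
    by rewrite /= -[top_sym _ _ _]/(slet g); case: (g).
  exact: dec_halt.
- have Et := cd_lam E.
  rewrite EM in hM eM; inversion hM as [| | |k' t' N p' hN|]; subst.
  inversion eM as [| | |? ? ? ? eN|]; subst.
  inversion hp as [|[ku a] ? s' ? hclo hs']; subst.
  have [ra /= ea EN] := hclo; have le_a := env_size ea.
  have h := exec_pop_clo s' (codeof t) ku (scode c) [:: slet g] le_eH
    (leq_trans le_a le_hH) le_hH.
  apply: (step (cost Hm)); first by lia.
    by rewrite /step_cmd E; exact: h.
  have hok' : all (cellok Hm) ((ku, a, e) :: hs).
    by rewrite /= /cellok /= le_eH hok (leq_trans le_a le_hH).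
  apply: (IH k' (codeof t) (size hs).+1 s' ((ku, a, e) :: hs)) hN eN _ _ _ _ hok' _.
  + exists (N :: r); last by rewrite Et inst_ups; apply: eq_subst; case.
    rewrite EN; apply: (@env_cons _ _ (ku, a, e) hs) => //.
    * by rewrite /= subnn drop0.
    * exact: env_extend.
    * exact: env_extend.
  + exact: clos_extend.
  (* The beta step has used one unit of the old [k], so the new pointer is still at most [Hm]. *)
  + have : (size hs).+1 * A.+1 <= Hm * A.+1 by rewrite leq_mul2r; apply/orP; right; lia.
    have := csize_cd (codeof t); rewrite Et.
    by move: hPhi; rewrite !mulSn; lia.
  + by rewrite /=; lia.
  + by move: hZ; rewrite /stackw /= size_cat /= -/(stackw s'); nia.
- have [Et Eu] := cd_app E.
  rewrite EM in hM eM; inversion hM; subst; inversion eM; subst.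
  have h := exec_push_clo (heapw hs) (nseq (size hs) sone) s (codeof t) (codeof u)
    (scode c) [:: slet g] le_eH.
  apply: (step (cost Hm)); first by lia.
    by rewrite /step_cmd E; exact: h.
  apply: (IH k (codeof t) e ((codeof u, e) :: s)) H3 H4 _ _ _ hk hok _.
  + by exists r; rewrite // Et.
  + by constructor=> //; exists r; rewrite // Eu.
  + by rewrite Et; lia.
  + by rewrite /stackw /= size_cat /= size_cat size_nseq /= -/(stackw s); nia.
- have [Et Eu Ev] := cd_if E.
  rewrite EM in hM eM; inversion hM as [| | | |k' ? ? ? ? ht hu hv]; subst.
  inversion eM as [| | | |? ? ? ? c0 ? et euv]; subst.
  have guard_dec b0 : dec ((2 * Z + 8) + Phi * step_cost)
      [:: guard (codeof t) b0; run] (kstate hs e s c g) (c0 == b0).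
    have h : exec (2 * Z + 6) (guard (codeof t) b0) (kstate hs e s c g)
        (kstate hs e [::] (codeof t) b0).
      apply: exec_le; last first.
        rewrite /guard /kstate /mk1.
        eapply exec_seq; first by apply: exec_drop_all; exact: stackw_nblank.
        rewrite setr_mk.
        xseq exec_setC.
        by xend exec_setC.
      by rewrite /mk /=; lia.
    apply: (@dec_le _ _ (2 * Z + 6 + Phi * step_cost)); first by lia.
    apply: exec_dec h _.
    apply: (IH k' (codeof t) e [::]) ht et _ _ _ _ hok _.
    + by exists r; rewrite // Et.
    + by constructor.
    + by rewrite Et; nia.
    + by lia.
    + by rewrite /=; nia.
  have branch_dec w Mw bw : cd (codeof w) = w -> Mw = subst (nth (Var 0) r) w ->
      csize w < csize (If t u v) ->
      halts k' Mw p -> ev Mw p bw -> dec ((2 * Z + 8) + Phi * step_cost)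
      [:: SetC RC (scode (codeof w)); run] (kstate hs e s c g) (bw == g).
    move=> Ew EMw cw hw ew.
    apply: (@dec_le _ _ (1 + Phi * step_cost)); first by lia.
    have h : exec 1 (SetC RC (scode (codeof w))) (kstate hs e s c g)
        (kstate hs e s (codeof w) g).
      by apply: exec_eq (exec_setC _ _ _ _) _; rewrite /kstate /mk1 setr_mk.
    apply: exec_dec h _.
    apply: (IH k' (codeof w) e s) hw ew _ hp _ _ hok _.
    + by exists r; rewrite // Ew.
    + by move: cw; rewrite Ew /=; nia.
    + by lia.
    + by nia.
  (* By [halts] the branch not taken has a value too, as [dec] demands; the wrong guess fails at its
     guard, so that value does not affect the result. *)
  have [bu eu] := halts_ev hu; have [bv ev'] := halts_ev hv.
  have -> : (b == g) = ((c0 == true) && ((if c0 then b else bu) == g)) ||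
      ((c0 == false) && ((if c0 then bv else b) == g)).
    by case: (c0); rewrite /= ?orbF ?orFb.
  apply: (@dec_le _ _ (n + 2 + (2 * Z + 8 + Phi * step_cost).+2)).
    by rewrite mulSn /step_cost; lia.
  apply: dec_run topc _; rewrite /step_cmd E.
  case: c0 et euv guard_dec => et euv guard_dec.
    apply: dec_or; apply: dec_and; try exact: guard_dec.
      by apply: branch_dec Eu erefl _ hu euv; rewrite /=; lia.
    by apply: branch_dec Ev erefl _ hv ev'; rewrite /=; lia.
  apply: dec_or; apply: dec_and; try exact: guard_dec.
    by apply: branch_dec Eu erefl _ hu eu; rewrite /=; lia.
  by apply: branch_dec Ev erefl _ hv euv; rewrite /=; lia.
Qed.
End Program.

(** * The finite set of codes and the initial heap *)

Lemma tm_eq_dec (t u : tm) : decidable (t = u).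
Proof. by rewrite /decidable; decide equality; apply: eq_comparable. Defined.

HB.instance Definition _ := hasDecEq.Build tm (compareP tm_eq_dec).

(* The last clause lets a variable [m.+1] be looked up by first moving to the
   parent environment. *)
Fixpoint subs (t : tm) : seq tm :=
  t :: match t with
       | Lam t => subs t
       | App t u => subs t ++ subs u
       | If t u v => subs t ++ subs u ++ subs v
       | Var m => map Var (iota 0 m)
       | _ => [::]
       end.

Lemma mem_subs t : t \in subs t.
Proof. by case: t => *; rewrite inE eqxx. Qed.

Definition children (t : tm) : seq tm :=
  match t with
  | Var m.+1 => [:: Var m]
  | Lam t => [:: t]
  | App t u => [:: t; u]
  | If t u v => [:: t; u; v]
  | _ => [::]
  end.

Definition child_closed (s : seq tm) :=
  forall t, t \in s -> {subset children t <= s}.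

Lemma child_closed_cat s s' :
  child_closed s -> child_closed s' -> child_closed (s ++ s').
Proof.
move=> h h' t; rewrite mem_cat => /orP[/h H|/h' H] u /H us;
  by rewrite mem_cat us ?orbT.
Qed.

Lemma child_closed_cons t s :
  {subset children t <= s} -> child_closed s -> child_closed (t :: s).
Proof.
move=> ts hs u; rewrite inE => /predU1P[->|/hs us] v vu; rewrite inE.
  by rewrite ts ?orbT.
by rewrite us ?orbT.
Qed.

Lemma child_closed_subs t : child_closed (subs t).
Proof.
elim: t => [m|||t IH|t IHt u IHu|t IHt u IHu v IHv] /=; apply: child_closed_cons.
- case: m => // m u; rewrite inE => /eqP->; apply: map_f.
  by rewrite mem_iota; lia.
- move=> t /mapP[[|j]]; rewrite mem_iota => /= jm -> // u; rewrite inE => /eqP->.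
  by apply: map_f; rewrite mem_iota; lia.
- by [].
- by [].
- by [].
- by [].
- by move=> u; rewrite inE => /eqP->; apply: mem_subs.
- by [].
- by move=> v; rewrite !inE mem_cat => /orP[]/eqP->; rewrite mem_subs ?orbT.
- exact: child_closed_cat.
- by move=> w; rewrite !inE !mem_cat => /or3P[]/eqP->; rewrite mem_subs ?orbT.
- by do 2!apply: child_closed_cat => //.
Qed.

Section Machine.
Variable t : tm.

(** The [Var 0] applied to is the input: the program starts in an environment whose only entry is
    the word. *)
Definition codes : seq tm :=
  subs (App t (Var 0)) ++ subs nilc ++ subs (consc false) ++ subs (consc true).

Definition ncodes : nat := (size codes).-1.

Definition cd (k : 'I_ncodes.+1) : tm := nth (Var 0) codes k.
Definition codeof (u : tm) : 'I_ncodes.+1 := inord (index u codes).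

Lemma size_codes : size codes = ncodes.+1.
Proof. by rewrite /ncodes /codes /= . Qed.

Lemma codeofK u : u \in codes -> cd (codeof u) = u.
Proof.
move=> uc; rewrite /cd /codeof inordK ?nth_index //.
by rewrite -size_codes index_mem.
Qed.

Lemma cd_children k u : u \in children (cd k) -> cd (codeof u) = u.
Proof.
have cc : child_closed codes.
  do 3!(apply: child_closed_cat; first exact: child_closed_subs).
  exact: child_closed_subs.
by move=> uk; apply/codeofK/(cc _ _ _ uk)/mem_nth; rewrite size_codes.
Qed.

Definition csize_max : nat := \max_(u <- codes) csize u.

Lemma csize_cd k : csize (cd k) <= csize_max.
Proof.
apply: (@leq_bigmax_seq _ _ predT csize) => //.
by apply: mem_nth; rewrite size_codes.
Qed.

Notation n := ncodes.
Notation sym := (bool + bool * bool + 'I_n.+1)%type.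
Notation sblank := (sblank n).
Notation sone := (sone n).
Notation ssep := (ssep n).
Notation send := (send n).
Notation slet := (slet n).
Notation cmd := (cmd sym).
Notation exec := (@exec sym sblank).
Notation dec := (@dec sym sblank).

Definition push_letter : cmd :=
  Seq (push RH send) (Seq (push RH ssep) (Seq (dup RK sone RH RB)
    (Seq (mvw RB sone true RK)
      (Seq (Ifc RT (slet true) (push RH (scode (codeof (consc true))))
                               (push RH (scode (codeof (consc false)))))
        (Seq (push RK sone) (Pop _ RT)))))).

(** Moving the input to [RT] reverses it, so the chain is built from the last letter and each new
    cell points to the part already stored. *)
Definition init : cmd :=
  Seq (mvw RIn sblank false RT) (Seq (push RH send) (Seq (push RH ssep)
    (Seq (push RH (scode (codeof nilc))) (Seq (push RK sone)
      (Seq (While RT sblank false push_letter)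
        (Seq (dup RK sone RE RB) (Seq (mvw RB sone true RK)
          (Seq (push RG (slet true))
               (push RC (scode (codeof (App t (Var 0))))))))))))).

Fixpoint word_heap (w : word) : seq (cell n) :=
  if w is b :: v then (codeof (consc b), (size v).+1, 0) :: word_heap v
  else [:: (codeof nilc, 0, 0)].

Lemma size_word_heap w : size (word_heap w) = (size w).+1.
Proof. by elim: w => //= b w ->. Qed.

Lemma exec_push_letter b v u M : size v < M ->
  exec (16 * M + 30) push_letter
    (mk1 (heapw (word_heap v)) [::] [::] (slet b :: u) (nseq (size v).+1 sone)
         [::] [::] [::])
    (mk1 (heapw (word_heap (b :: v))) [::] [::] u (nseq (size v).+2 sone)
         [::] [::] [::]).
Proof.
move=> vM; apply: exec_le; last first.
  rewrite /push_letter /mk1.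
  xseq exec_push.
  xseq exec_push.
  eapply exec_seq.
    by eapply (exec_dup (n := (size v).+1)); [done|done|done|exact: (esym (cats0 _))|].
  rewrite !setr_mk !cats0.
  eapply exec_seq.
    eapply (exec_mvw (u := nseq (size v).+1 sone) (r := [::])); rewrite ?cats0 //.
    by rewrite all_nseq orbT.
  rewrite !setr_mk catrev_nseq cats0.
  eapply exec_seq.
    apply: (exec_if (st' := mk1 (heapw (word_heap (b :: v))) [::] [::] (slet b :: u)
      (nseq (size v).+1 sone) [::] [::] [::])).
    rewrite /top_sym /=; case: b; xend exec_push;
      by rewrite /heapw /= /cellw /= -!catA.
  xseq exec_push.
  by xend exec_pop.
by rewrite size_nseq; lia.
Qed.

Lemma exec_letters u v M : size u + size v < M ->
  exec (size u * (16 * M + 31)).+1 (While RT sblank false push_letter)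
    (mk1 (heapw (word_heap v)) [::] [::] (map slet u) (nseq (size v).+1 sone)
         [::] [::] [::])
    (mk1 (heapw (word_heap (catrev u v))) [::] [::] [::]
         (nseq (size u + size v).+1 sone) [::] [::] [::]).
Proof.
elim: u v => [|b u IH] v uvM; first exact: exec_while_false.
apply: (@exec_le _ _ (16 * M + 30 + (size u * (16 * M + 31)).+1).+1).
  by rewrite /= mulSn; lia.
apply: exec_while_true; first by [].
  by apply: exec_push_letter; move: uvM => /=; lia.
have := IH (b :: v); rewrite /= addnS; apply.
by move: uvM => /=; lia.
Qed.

Notation start_store w := (kstate (word_heap w) (size w).+1 [::]
  (codeof (App t (Var 0))) true).

Lemma exec_init w :
  exec (100 * (size w).+1 ^ 2) init (input_store slet w) (start_store w).
Proof.
have -> : input_store slet w =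
    mk (map slet w) [::] [::] [::] [::] [::] [::] [::] [::].
  by apply: functional_extensionality => -[].
apply: exec_le; last first.
  rewrite /init.
  eapply exec_seq.
    apply: (exec_mvw (u := map slet w) (r := [::])); rewrite ?cats0 //.
    by rewrite all_map; apply/allP.
  rewrite setr_mk catrevE cats0 setr_mk -map_rev.
  xseq exec_push.
  xseq exec_push.
  xseq exec_push.
  xseq exec_push.
  eapply exec_seq.
    by apply: (@exec_letters (rev w) [::] (size w).+1); rewrite size_rev addn0.
  rewrite catrevE revK cats0 size_rev addn0 /mk1.
  eapply exec_seq.
    by eapply (exec_dup (n := (size w).+1)); [done|done|done|exact: (esym (cats0 _))|].
  rewrite !setr_mk !cats0.
  eapply exec_seq.
    eapply (exec_mvw (u := nseq (size w).+1 sone) (r := [::])); rewrite ?cats0 //.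
    by rewrite all_nseq orbT.
  rewrite !setr_mk catrev_nseq cats0.
  xseq exec_push.
  xend exec_push.
  by rewrite /kstate size_word_heap.
rewrite size_map size_rev size_nseq -mulnn; nia.
Qed.

Lemma env_word_heap w : env cd (word_heap w) (size w).+1 [:: chu w].
Proof.
have codesP u : u \in [:: nilc; consc false; consc true] -> cd (codeof u) = u.
  by rewrite !inE => /or3P[]/eqP->; apply: codeofK;
    rewrite /codes !mem_cat mem_subs ?orbT.
elim: w => [|b w IH].
  have := @env_cons _ cd (word_heap [::]) 0 (codeof nilc, 0, 0) [::] [::] [::].
  rewrite /= codesP //; apply=> //; exact: env_nil.
have := @env_cons _ cd (word_heap (b :: w)) (size w).+1
  (codeof (consc b), (size w).+1, 0) (word_heap w) [:: chu w] [::].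
rewrite [(_, _, _).1.1]/= codesP; last by case: b.
apply=> //.
- by rewrite size_word_heap subnn drop0.
- exact: size_word_heap.
- exact: env_extend.
- exact: env_nil.
Qed.
End Machine.

(** * Total running time and the represented language *)

Section Final.
Variable t : tm.
Hypothesis t_closed : closed_tm t.

Notation n := (ncodes t).
Notation sym := (bool + bool * bool + 'I_n.+1)%type.

Definition main_cmd : cmd sym := Seq (init t) (run (@cd t) (@codeof t)).

Lemma slet_inj : injective (@slet n). Proof. by move=> b c []. Qed.

Lemma slet_blank b : @slet n b != sblank n. Proof. by []. Qed.

Definition krivine_atm : atm := stack_atm slet_inj slet_blank main_cmd.

(** For [X] head steps the heap has at most [2 * X] cells, half of them initial. With
    [A = csize_max t], the starting potential is at most [X * (2 * X + 1) * A.+1 + X * A.+1 + A],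
    which lies below this value. *)
Definition phi_bound (X : nat) : nat := 5 * (csize_max t).+1 * X ^ 2.

Definition space_bound (X : nat) : nat := 4 * X * phi_bound X.

Definition total_bound (X : nat) : nat :=
  101 * X ^ 2 + phi_bound X * step_cost n (2 * X) (space_bound X) + 1.

Lemma dec_main X w b :
  (size w).+1 <= X -> halts X (App t (chu w)) [::] ->
  ev (App t (chu w)) [::] b ->
  dec (sblank n) (total_bound X) [:: main_cmd] (input_store (@slet n) w) b.
Proof.
move=> wX hX eb; set A := csize_max t.
have main_code : cd (codeof t (App t (Var 0))) = App t (Var 0).
  by apply: codeofK; rewrite /codes mem_cat mem_subs.
have sH := size_word_heap t w.
have d : dec (sblank n) (phi_bound X * step_cost n (2 * X) (space_bound X))
    [:: run (@cd t) (@codeof t)]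
    (kstate (word_heap t w) (size w).+1 [::] (codeof t (App t (Var 0))) true)
    (b == true).
  apply: (@dec_krivine n (@cd t) (@codeof t) _ _ _ _ A _ _ _ _ X _ _ _ _
    (App t (chu w)) [::]) => //.
  - by move=> k m E; apply: (cd_children (k := k)); rewrite E mem_head.
  - by move=> k u E; apply: (cd_children (k := k)); rewrite E mem_head.
  - by move=> k u v E; split; apply: (cd_children (k := k));
      rewrite E !inE eqxx ?orbT.
  - by move=> k u v v' E; split; apply: (cd_children (k := k));
      rewrite E !inE eqxx ?orbT.
  - exact: csize_cd.
  - exists [:: chu w]; first exact: env_word_heap.
    by rewrite main_code /= closed_subst.
  - by constructor.
  - have := csize_cd (codeof t (App t (Var 0))); rewrite -/A /phi_bound -/A.
    rewrite -mulnn; nia.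
  - by rewrite sH; lia.
  - elim: w wX {hX eb sH} => [|c w IH] //= wX; rewrite IH ?andbT /cellok /=; lia.
  - by rewrite /space_bound /=; nia.
rewrite eqb_id in d.
have := exec_dec (exec_init t w) d => d'.
have d2 := @dec_det _ (sblank n) _ [:: main_cmd] _ _ (Nop _) _ (erefl _) d'.
apply: dec_le d2; rewrite /total_bound.
have : (size w).+1 ^ 2 <= X ^ 2 by rewrite leq_exp2r.
by lia.
Qed.

(** There are O(X^2) transitions, each costing O(X^3); the latter comes from the stack, whose length
    is bounded by [space_bound X] and which a guard may have to erase. *)
Lemma total_bound_le : exists C, forall X, 0 < X -> total_bound X <= C * X ^ 5.
Proof.
set A := csize_max t.
exists (102 + (5 * A.+1) * (n + 1370 + 40 * A.+1)) => X X0.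
have pow k : 0 < X ^ k by rewrite expn_gt0 X0.
have X2 : X ^ 2 <= X ^ 5 by rewrite leq_pexp2l.
have X23 : X ^ 2 <= X ^ 3 by rewrite leq_pexp2l.
have X13 : X <= X ^ 3 by rewrite -{1}[X]expn1 leq_pexp2l.
have sc : step_cost n (2 * X) (space_bound X) <= (n + 1370 + 40 * A.+1) * X ^ 3.
  rewrite /step_cost /space_bound /phi_bound -/A costE.
  have -> : 2 * (4 * X * (5 * A.+1 * X ^ 2)) = 40 * A.+1 * X ^ 3.
    by rewrite (expnS X 2); lia.
  have -> : 2 * X * (2 * X) = 4 * X ^ 2 by rewrite -mulnn; lia.
  have : n <= n * X ^ 3 by rewrite leq_pmulr.
  by have := pow 3; rewrite !mulnDl; lia.
have X5 : X ^ 5 = X ^ 2 * X ^ 3 by rewrite -expnD.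
have : phi_bound X * step_cost n (2 * X) (space_bound X) <=
       (5 * A.+1) * (n + 1370 + 40 * A.+1) * X ^ 5.
  apply: leq_trans (leq_mul (leqnn _) sc) _.
  by rewrite /phi_bound -/A X5; nia.
by have := pow 5; rewrite /total_bound (mulnDl 102); lia.
Qed.

Lemma leq_size_app w :
  (size w).+1 <= tmsize (App t (church w)) <= (tmsize t + 6) * (size w).+1.
Proof.
have -> : tmsize (App t (church w)) = tmsize t + 2 * size w + 5.
  rewrite churchE /= (_ : tmsize (body w) = 2 * size w + 1); first by lia.
  by elim: w => //= b w ->; lia.
by apply/andP; split; nia.
Qed.

(** The machine evaluates [chu w] in place of [church w]. As the first reduces to the second,
    confluence gives both applications the same boolean normal form. *)
Lemma lang_ev w b : ev (App t (chu w)) [::] b -> b <-> lang t w.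
Proof.
move=> /ev_reds /= eb.
have tw : reds (App t (chu w)) (App t (church w)).
  by apply: reds_app (rt_refl _ _ _) (reds_chu w).
split=> [bt|[tT _]].
  rewrite bt in eb; split; last exact: (@normal_bool true).
  exact: reds_confluent_bool eb tw.
have tT' : reds (App t (chu w)) (bool_tm true) by apply: rt_trans tw tT.
by rewrite (reds_bool_inj eb tT').
Qed.

Lemma leq_exp_succ s E : s.+1 ^ E <= 2 ^ E * s ^ E + 2 ^ E.
Proof.
case: s => [|s]; first by rewrite exp1n; have := expn_gt0 2 E; lia.
apply: leq_trans (leq_addr _ _); rewrite -expnMn.
by case: E => // E; rewrite leq_exp2r //; lia.
Qed.

Lemma decides_le M (L : language) (T T' : word -> nat) :
  (forall w, T w <= T' w) -> decides_within M L T -> decides_within M L T'.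
Proof.
move=> le_T h w; have [hT hL] := h w; split=> // s /hT /leq_trans; exact.
Qed.

End Final.

Theorem theorem7 (t : tm) (n d : nat) (t_closed : closed_tm t)
    (t_typed :
       has_deriv_of_depth d [::] [::] t (Arr tyW (iter n Par Bool)) \/
       has_deriv_of_depth d [::] [::] t (Lin tyW (iter n Par Bool))) :
  (exists (M : atm) (c : nat),
     decides_within M (lang t)
       (fun w => c * tmsize (App t (church w)) ^ (3 ^ (d + 4)))) /\
  APTIME (lang t).
Proof.
have [C0 hC0] := typed_halts t_closed t_typed.
have [C1 hC1] := total_bound_le t.
set E := 3 ^ (d + 4).
(* The degree of the head reduction bound times the degree 5 of the machine: [20 * 2 ^ d] against
   [81 * 3 ^ d]. *)
have lt_E : 4 * 2 ^ d * 5 <= E.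
  have : 2 ^ d <= 3 ^ d by case: (d) => // k; rewrite leq_exp2r.
  by rewrite /E expnD; lia.
pose c := C1 * (C0.+1 ^ (4 * 2 ^ d)) ^ 5.
have dM : decides_within (krivine_atm t) (lang t)
    (fun w => c * tmsize (App t (church w)) ^ E).
  apply: stack_atm_decides => w.
  (* The successor of [C0] makes [X] positive and at least [(size w).+1]. *)
  pose X := (C0.+1 * (size w).+1) ^ (4 * 2 ^ d).
  have X0 : 0 < X by rewrite expn_gt0.
  have wX : (size w).+1 <= X.
    apply: leq_trans (_ : C0.+1 * (size w).+1 <= _); first exact: leq_pmull.
    by rewrite -{1}[_ * _]expn1 leq_pexp2l // muln_gt0 expn_gt0.
  have hX : halts X (App t (chu w)) [::].
    by apply: halts_le (hC0 w); rewrite leq_exp2r ?muln_gt0 ?expn_gt0 // leq_mul.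
  have [b eb] := halts_ev hX.
  exists b; last exact: lang_ev.
  apply: dec_le (dec_main t_closed wX hX eb).
  apply: leq_trans (hC1 _ X0) _; rewrite /c /X -mulnA leq_mul2l; apply/orP; right.
  rewrite expnMn expnMn leq_mul2l; apply/orP; right.
  have /andP[wm _] := leq_size_app t w; rewrite -expnM.
  apply: (@leq_trans (tmsize (App t (church w)) ^ (4 * 2 ^ d * 5))).
    by rewrite leq_exp2r ?muln_gt0 ?expn_gt0.
  by rewrite leq_pexp2l.
split; first by exists (krivine_atm t), c.
(* The size of the applied term is linear in that of the word, and [2 ^ E] comes from replacing
   [(size w).+1] by [size w] plus an additive constant. *)
pose c' := c * (tmsize t + 6) ^ E * 2 ^ E.
exists (krivine_atm t), c', E; apply: decides_le dM => w.
have /andP[_ mw] := leq_size_app t w.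
have E0 : 0 < E by rewrite expn_gt0.
apply: (@leq_trans (c * ((tmsize t + 6) * (size w).+1) ^ E)).
  by rewrite leq_mul2l leq_exp2r // mw orbT.
rewrite expnMn mulnA /c' -!mulnA -!mulnDr !leq_mul2l.
by rewrite leq_exp_succ !orbT.
Qed.
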